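(* Let $(X,d)$ be a complete separable metric space and $I=(0,T)\subset\mathbb{R}$ with $0<T<\infty$. Let $(\mu_t)\in\mathcal{BV}(I;(\mathcal{P}(X),W_1))$. Then there exists a probability measure $\pi\in\mathcal{P}(D(I;X))$ such that (i) $\pi$ is concentrated on $\mathcal{BV}(I;X)\subset D(I;X)$; (ii) $(e_t)_\#\pi=\mu_t$ for all $t\in I$, where $e_t(\gamma)=\gamma_t$; (iii) $\pi$ realizes the variation measure $|\mathrm{D}\mu|$ in the sense that $|\mathrm{D}\mu|=\int|\mathrm{D}\gamma|\,\mathrm{d}\pi(\gamma)$ (as measures on $I$).
   Context: $\mathcal{P}(X)$: Borel probability measures on $X$; $W_1$ is the extended ($[0,+\infty]$-valued) 1-Wasserstein distance on $\mathcal{P}(X)$, $W_1(m_0,m_1)=\inf\int d\,\mathrm{d}\sigma$ over couplings $\sigma$; $(\mathcal{P}(X),W_1)$ is a complete extended metric space. For a complete (possibly extended, i.e. distance may be $+\infty$) metric space $(Y,d_Y)$ and $\gamma:I\to Y$, $\mathrm{Var}(\gamma;A)=\sup\sum_i d_Y(\gamma_{t_i},\gamma_{t_{i+1}})$ over finite increasing $t_0<\dots<t_{k+1}$ in $A\subset I$; $\mathrm{ess\,Var}(\gamma;A)=\inf\{\mathrm{Var}(\tilde\gamma;A):\tilde\gamma=\gamma\text{ a.e. on }A\}$. $\mathcal{BV}(I;Y)$ is the set of càdlàg curves (right-continuous with left limits) $\gamma:I\to Y$ with $\mathrm{ess\,Var}(\gamma;I)<\infty$. $|\mathrm{D}\gamma|$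 is the finite Borel measure on $I$ with $|\mathrm{D}\gamma|((a,b))=\mathrm{ess\,Var}(\gamma;(a,b))$ for all $(a,b)\subset I$; $|\mathrm{D}\mu|$ is this measure for the curve $t\mapsto\mu_t$ in $(\mathcal{P}(X),W_1)$. $D(I;X)$ is the space of càdlàg curves $I\to X$ with the Skorokhod topology (its Borel $\sigma$-algebra is generated by the evaluation maps $e_t$). $\int|\mathrm{D}\gamma|\,\mathrm{d}\pi(\gamma)$ is the measure $B\mapsto\int|\mathrm{D}\gamma|(B)\,\mathrm{d}\pi(\gamma)$. *)

(* Defs.v *)
From HB Require Import structures.
From mathcomp Require Import all_boot all_order all_algebra.
From mathcomp Require Import all_classical all_reals all_analysis.
From mathcomp Require Import measurable_realfun.

Set Implicit Arguments.
Unset Strict Implicit.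
Unset Printing Implicit Defensive.

Import Order.TTheory GRing.Theory Num.Theory.
Import numFieldNormedType.Exports.

Local Open Scope classical_set_scope.
Local Open Scope ring_scope.

(* The library's complete spaces and measurable types are pointed, so spaces of
   this type are nonempty.  A space carrying a probability measure is nonempty
   anyway. *)
#[short(type="completeMetricType")]
HB.structure Definition CompleteMetric (R : numDomainType) :=
  { X of CompletePseudoMetric R X & PseudoMetric_isMetric R X }.

Definition separable_space (X : topologicalType) : Prop :=
  exists2 S : set X, countable S & dense S.

Definition time (R : realType) (T : R) : Type := {t : R | 0 < t < T}.

HB.instance Definition _ (R : realType) (T : R) :=
  Choice.copy (time T) {t : R | 0 < t < T}.

(* Curves with values in an extended metric space, the latter given by its
   [0, +oo]-valued distance function. *)
Section curves.
Context (R : realType) (T : R) (Y : Type) (dist : Y -> Y -> \bar R).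
Implicit Types (g : time T -> Y) (A : set (time T)).

Definition cadlag g : Prop := forall t : time T,
  (forall e : R, 0 < e -> \forall r \near (val t)^'+,
     forall s : time T, val s = r -> (dist (g s) (g t) < e%:E)%E) /\
  (exists y : Y, forall e : R, 0 < e -> \forall r \near (val t)^'-,
     forall s : time T, val s = r -> (dist (g s) y < e%:E)%E).

(* zip s (behead s) lists the pairs of consecutive elements of s. *)
Definition curve_var g A : \bar R :=
  ereal_sup [set (\sum_(p <- zip s (behead s)) dist (g p.1) (g p.2))%E
    | s in [set s : seq (time T) |
        sorted [rel t u : time T | val t < val u] s /\
        (forall t, t \in s -> A t)]].

Definition ess_var g A : \bar R :=
  ereal_inf [set curve_var g' A
    | g' in [set g' : time T -> Y |
        (@lebesgue_measure R).-negligible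
          [set val t | t in [set t | A t /\ g' t <> g t]]]].

Definition bv_curve g : Prop := cadlag g /\ (ess_var g setT < +oo)%E.

(* Borel measures on the interval (0, T) are represented by the Borel measures
   on the line that vanish on its complement. *)
Definition is_variation_measure g
    (m : {finite_measure set (measurableTypeR R) -> \bar R}) : Prop :=
  m (~` `]0, T[%classic) = 0%E /\
  forall a b : R, 0 <= a -> a < b -> b <= T ->
    m `]a, b[%classic = ess_var g [set t | a < val t < b].

(* |Dg|: the measure characterized by is_variation_measure, which exists and is
   unique for g in BV; the zero measure if there is no such measure. *)
Definition variation_measure g :
    {finite_measure set (measurableTypeR R) -> \bar R} :=
  match pselect (exists m, is_variation_measure g m) with
  | left h => projT1 (cid h)
  | right _ => mzero
  end.

End curves.

Definition borel (R : realType) (X : completeMetricType R) :=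
  g_sigma_algebraType (@open X).

Definition emdist (R : realType) (X : completeMetricType R) (x y : X) : \bar R :=
  (mdist x y)%:E.

Section wasserstein.
Context (R : realType) (X : completeMetricType R).

(* Couplings live on the product sigma-algebra, which for a separable X is the
   Borel sigma-algebra of X * X. *)
Definition coupling (m0 m1 : probability (borel X) R) :
    set (probability (borel X * borel X)%type R) :=
  [set s : probability (borel X * borel X)%type R |
     forall B : set (borel X), measurable B ->
     pushforward s fst B = m0 B /\ pushforward s snd B = m1 B].

Definition W1 (m0 m1 : probability (borel X) R) : \bar R :=
  ereal_inf [set (\int[s]_z emdist (z.1 : X) (z.2 : X))%E
    | s in coupling m0 m1].

End wasserstein.

Section cadlag_space.
Context (R : realType) (X : completeMetricType R) (T : R).

Definition cadlag_curve : Type :=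
  {g : time T -> X | `[< cadlag (@emdist R X) g >]}.

HB.instance Definition _ := Choice.copy cadlag_curve
  {g : time T -> X | `[< cadlag (@emdist R X) g >]}.

Lemma cadlag_cst : `[< cadlag (@emdist R X) (fun _ : time T => point : X) >].
Proof.
apply/asboolP => t; split; last exists point;
  by move=> e e0; apply: nearW => r s _; rewrite /emdist mdistxx lte_fin.
Qed.

HB.instance Definition _ :=
  isPointed.Build cadlag_curve
    (exist (fun g : time T -> X => `[< cadlag (@emdist R X) g >]) _ cadlag_cst).

Definition evaluation (t : time T) (g : cadlag_curve) : borel X := val g t.

(* D(I; X) as a measurable space.  The Borel sigma-algebra of the Skorokhod
   topology is the one generated by the evaluation maps; it is the only datum
   of that topology that a probability measure on D(I; X) depends on. *)
Definition evaluation_cylinders : set (set cadlag_curve) :=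
  [set evaluation tB.1 @^-1` tB.2 | tB in
    [set tB : time T * set (borel X) | measurable tB.2]].

Definition cadlag_space := g_sigma_algebraType evaluation_cylinders.

End cadlag_space.
Arguments cadlag_space {R} X T.

(* Main.v *)
(* The joint law of (gamma_s, gamma_t) is a coupling of mu_s and mu_t, so the
   variation of a lift is on average at least that of mu, and it suffices to find a
   lift with E Var(gamma; (0, b)) <= Var(mu; (0, b)) for all b.
   For finitely many times, nearly optimal couplings of consecutive marginals are
   composed into a Markov chain; conditioning on the cells of a countable partition
   into small sets replaces disintegration.  For each mesh, the joint laws of the
   cells visited by these chains converge along an ultrafilter; since the marginals
   are prescribed, no mass escapes, and neither tightness nor Prokhorov's theorem is
   needed.  The limit law is realized on [0, 1) by nested intervals, and completeness
   of X turns it into a process indexed by a countable dense set of times, with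
   E d(gamma_s, gamma_t) <= |Dmu|((s, t]).  By monotone convergence its paths have
   finite variation almost surely, so they have right limits, which form a cadlag
   curve of no larger variation; right continuity of mu gives its marginals. *)

Require Import Defs.
From HB Require Import structures.
From mathcomp Require Import all_boot all_order all_algebra.
From mathcomp Require Import all_classical all_reals all_analysis.
From mathcomp Require Import measurable_realfun.
From mathcomp Require Import ring lra.

Set Implicit Arguments.
Unset Strict Implicit.
Unset Printing Implicit Defensive.

Import Order.TTheory GRing.Theory Num.Theory.
Import numFieldNormedType.Exports.

Local Open Scope classical_set_scope.
Local Open Scope ring_scope.

(** * Variation of curves in extended metric spaces *)

(** [W1] may be infinite and [X] need not be locally compact, so all estimates go through one finite
    real function of time, the cumulative variation of [mu], whose increments bound [W1] and add up
    along chains. Optimal couplings are replaced by nearly optimal ones: a slack proportional to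
    elapsed time, again additive along a chain, pays both for near-optimality and for gluing through
    cells. Along the ultrafilter only probabilities of events decided by finitely many cells
    converge. Mean distances are therefore tested by finite partial sums of distances between cell
    centres, at a fixed mesh; the slack vanishes first, then the truncation is removed, then the
    mesh tends to 0. Tightness is replaced by countable additivity: the limiting masses of the cells
    of one mesh at one time are those of a probability measure, hence sum to 1. Both sides of the
    final identity are compared on the intervals []0, b[] only. There each side is an honest
    variation, because essential and pointwise variation agree for right-continuous curves, and
    finiteness of the total mass extends the identity to Borel sets. *)

Section ext_dist.
Context (R : realType) (Y : Type).

Record ext_dist (dist : Y -> Y -> \bar R) : Prop := ExtDist {
  ext_dist_ge0 : forall x y, (0 <= dist x y)%E ;
  ext_distxx : forall x, dist x x = 0%E ;
  ext_dist_sym : forall x y, dist x y = dist y x ;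
  ext_dist_tri : forall x y z, (dist x z <= dist x y + dist y z)%E }.

End ext_dist.

(** Membership of 0 in both sets makes [c] nonnegative and, when [c] is finite, makes [ereal_sup A]
    finite, so that moving terms across the inequality is legitimate. *)
Lemma ereal_supD_le (R : realType) (A B : set (\bar R)) (c : \bar R) :
  A 0%E -> B 0%E ->
  (forall x y, A x -> B y -> (x + y <= c)%E) ->
  (ereal_sup A + ereal_sup B <= c)%E.
Proof.
move=> A0 B0 AB.
have [->|cy] := eqVneq c +oo%E; first by rewrite leey.
have cfin x y : A x -> B y -> (0 <= y)%E -> y \is a fin_num.
  move=> Ax By y0; rewrite ge0_fin_numE//.
  have := AB _ _ A0 By; rewrite add0e => /le_lt_trans; apply.
  by rewrite ltey.
have c0 : (0 <= c)%E by have := AB _ _ A0 B0; rewrite adde0.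
have cf : c \is a fin_num by rewrite ge0_fin_numE// ltey.
have sA y : B y -> (0 <= y)%E -> (ereal_sup A <= c - y)%E.
  move=> By y0; apply: ge_ereal_sup => x Ax.
  by rewrite leeBrDr ?(cfin 0%E y)// AB.
have sA0 : (0 <= ereal_sup A)%E by exact: ereal_sup_ubound.
have Afin : ereal_sup A \is a fin_num.
  rewrite ge0_fin_numE// (le_lt_trans (sA 0%E B0 _))//.
  by rewrite sube0 ltey.
rewrite -leeBrDl//; apply: ge_ereal_sup => y By.
rewrite leeBrDl//; have [y0|y0] := leP 0%E y.
  by rewrite -leeBrDr ?(cfin 0%E y)// sA.
by apply: (@le_trans _ _ (ereal_sup A + 0)%E);
  [exact/leeD2l/ltW|rewrite adde0 -(sube0 c) sA].
Qed.

Section variation.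
Context (R : realType) (T : R) (Y : Type) (dist : Y -> Y -> \bar R).
Context (hd : ext_dist dist).
Implicit Types (g : time T -> Y) (A B C E : set (time T)) (l : seq (time T))
  (s t u : time T).

Let dge0 := ext_dist_ge0 hd.
Let dxx := ext_distxx hd.
Let dsym := ext_dist_sym hd.
Let dtri := ext_dist_tri hd.

Definition tlt : rel (time T) := [rel t u : time T | val t < val u].

Lemma tlt_trans : transitive tlt.
Proof. by move=> t u v; exact: lt_trans. Qed.

Lemma tlt_irr : irreflexive tlt.
Proof. by move=> t; exact: ltxx. Qed.

Lemma tlt_total t u : t != u -> tlt t u || tlt u t.
Proof. by rewrite -val_eqE neq_lt. Qed.

Definition vsum g l : \bar R :=
  (\sum_(p <- zip l (behead l)) dist (g p.1) (g p.2))%E.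

Lemma vsum_nil g : vsum g [::] = 0%E.
Proof. by rewrite /vsum big_nil. Qed.

Lemma vsum1 g t : vsum g [:: t] = 0%E.
Proof. by rewrite /vsum big_nil. Qed.

Lemma vsum_cons2 g t u l :
  vsum g [:: t, u & l] = (dist (g t) (g u) + vsum g (u :: l))%E.
Proof. by rewrite /vsum /= big_cons. Qed.

Lemma vsum_ge0 g l : (0 <= vsum g l)%E.
Proof. by apply: sume_ge0 => p _; exact: dge0. Qed.

Lemma vsum_cat g l1 s l2 :
  vsum g (l1 ++ s :: l2) = (vsum g (rcons l1 s) + vsum g (s :: l2))%E.
Proof.
elim: l1 => [|t [|u l1] IH] /=; first by rewrite vsum1 add0e.
  by rewrite !vsum_cons2 vsum1 adde0.
by rewrite /= in IH; rewrite !vsum_cons2 IH addeA.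
Qed.

Lemma vsum_behead g t l : (vsum g l <= vsum g (t :: l))%E.
Proof.
by case: l => [|u l]; rewrite ?vsum_nil ?vsum_ge0// vsum_cons2 leeDr.
Qed.

Lemma vsum_subseq g l' l : subseq l' l -> (vsum g l' <= vsum g l)%E.
Proof.
(* Dropping an entry is paid for by the triangle inequality between its neighbours; the version with
   a head [t] supplies the left neighbour for the induction. *)
suff H k t l1 l2 : (size l2 <= k)%N -> subseq l1 l2 ->
    (vsum g (t :: l1) <= vsum g (t :: l2))%E /\ (vsum g l1 <= vsum g l2)%E.
  case: l' => [|t l'] sub; first by rewrite vsum_nil vsum_ge0.
  by have [] := H (size l) t _ _ (leqnn _) sub.
elim: k t l1 l2 => [|k IH] t l1 [|u l2] //=; rewrite ?subseq0.
- by move=> _ /eqP ->.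
- by move=> _ /eqP ->.
rewrite ltnS => kl2; case: l1 => [|v l1] /=.
  by rewrite vsum1 vsum_nil !vsum_ge0.
case: eqVneq => [->|vu] sub.
  have [H1 H2] := IH u _ _ kl2 sub.
  by split => //; rewrite !vsum_cons2 leeD2l.
have [H1 H2] := IH u _ _ kl2 sub.
have [H3 H4] := IH t _ _ kl2 sub.
split; last by rewrite (le_trans H2)// vsum_behead.
rewrite vsum_cons2 in H1; rewrite !vsum_cons2.
apply: le_trans (leeD2l _ H1); rewrite addeA leeD2r//.
Qed.

Lemma vsum_subset g l' l : sorted tlt l' -> sorted tlt l -> {subset l' <= l} ->
  (vsum g l' <= vsum g l)%E.
Proof.
move=> sl' sl sub.
have -> : l' = [seq t <- l | t \in l'].
  apply: (irr_sorted_eq tlt_trans tlt_irr) => //.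
    exact: (sorted_filter tlt_trans).
  move=> t; rewrite mem_filter.
  by case: (boolP (t \in l')) => //= /sub ->.
exact/vsum_subseq/filter_subseq.
Qed.

Lemma vsum_le_curve_var g l A : sorted tlt l -> (forall t, t \in l -> A t) ->
  (vsum g l <= curve_var dist g A)%E.
Proof. by move=> sl lA; apply: ereal_sup_ubound; exists l. Qed.

Lemma curve_var_le g A c :
  (forall l, sorted tlt l -> (forall t, t \in l -> A t) -> (vsum g l <= c)%E) ->
  (curve_var dist g A <= c)%E.
Proof. by move=> H; apply: ge_ereal_sup => _ [l [/= sl lA] <-]; exact: H. Qed.

Lemma curve_var_ge0 g A : (0 <= curve_var dist g A)%E.
Proof. by rewrite -(vsum_nil g) vsum_le_curve_var. Qed.

Lemma curve_varS g A B : A `<=` B ->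
  (curve_var dist g A <= curve_var dist g B)%E.
Proof.
move=> AB; apply: curve_var_le => l sl lA.
by apply: vsum_le_curve_var => // t /lA /AB.
Qed.

Lemma eq_curve_var g g' A : (forall t, A t -> g t = g' t) ->
  curve_var dist g A = curve_var dist g' A.
Proof.
suff H h h' : (forall t, A t -> h t = h' t) ->
    (curve_var dist h A <= curve_var dist h' A)%E.
  by move=> gg'; apply/eqP; rewrite eq_le !H// => t /gg'.
move=> hh'; apply: curve_var_le => l sl lA.
suff -> : vsum h l = vsum h' l by exact: vsum_le_curve_var.
elim: l lA {sl} => [|t [|u l] IH] lA; rewrite ?vsum_nil ?vsum1 ?vsum_cons2//.
rewrite (hh' t) ?(hh' u) ?IH//.
- by move=> v vl; apply: lA; rewrite inE vl orbT.
- by apply: lA; rewrite !inE eqxx orbT.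
- by apply: lA; rewrite inE eqxx.
Qed.

(** Inserts [s] in its place; the strict filters drop the copy of [s] that [l] may already
    contain. *)
Lemma sorted_pivot l s : sorted tlt l ->
  sorted tlt ([seq t <- l | tlt t s] ++ s :: [seq t <- l | tlt s t]).
Proof.
move=> sl; rewrite (sorted_pairwise tlt_trans) pairwise_cat /=.
rewrite -!(sorted_pairwise tlt_trans) !(sorted_filter tlt_trans)// !andbT.
apply/andP; split; last by apply/allP => t; rewrite mem_filter => /andP[].
apply/allrelP => t u; rewrite mem_filter inE => /andP[ts _].
by case/orP => [/eqP ->//|]; rewrite mem_filter => /andP[su _]; exact: tlt_trans ts su.
Qed.

(** Since [s] belongs to both halves, a sum passing through [s] splits exactly, and inserting [s]
    into a list only increases its sum. *)
Lemma curve_var_split g C s : C s ->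
  curve_var dist g C = (curve_var dist g (C `&` [set t | (val t <= val s)%R]) +
                   curve_var dist g (C `&` [set t | (val s <= val t)%R]))%E.
Proof.
move=> Cs; apply/eqP; rewrite eq_le; apply/andP; split.
  apply: curve_var_le => l sl lC.
  have sp := sorted_pivot s sl.
  apply: (@le_trans _ _ (vsum g ([seq t <- l | tlt t s] ++ s :: [seq t <- l | tlt s t]))).
    apply: vsum_subset => // t tl; rewrite mem_cat inE !mem_filter tl !andbT.
    have [//|/tlt_total/orP[->//|->]] := eqVneq t s; first by rewrite orbT.
    by rewrite !orbT.
  rewrite vsum_cat; apply: leeD; apply: vsum_le_curve_var.
  - move: sp; rewrite -cat_rcons; exact: (subseq_sorted tlt_trans (prefix_subseq _ _)).
  - move=> t; rewrite mem_rcons inE mem_filter => /orP[/eqP ->|/andP[ts tl]].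
      by split => //=.
    by split; [exact: lC|exact: ltW].
  - exact: (subseq_sorted tlt_trans (suffix_subseq _ _) sp).
  - move=> t; rewrite inE mem_filter => /orP[/eqP ->|/andP[ts tl]].
      by split => //=.
    by split; [exact: lC|exact: ltW].
apply: ereal_supD_le.
- by exists [::] => //; rewrite big_nil.
- by exists [::] => //; rewrite big_nil.
move=> _ _ [l1 [/= sl1 lC1] <-] [l2 [/= sl2 lC2] <-].
rewrite -!/(vsum _ _).
pose m1 := [seq t <- l1 | tlt t s]; pose m2 := [seq t <- l2 | tlt s t].
have sm : sorted tlt (m1 ++ s :: m2).
  rewrite (sorted_pairwise tlt_trans) pairwise_cat /=.
  rewrite -!(sorted_pairwise tlt_trans) !(sorted_filter tlt_trans)// !andbT.
  apply/andP; split; last by apply/allP => t; rewrite mem_filter => /andP[].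
  apply/allrelP => t u; rewrite mem_filter inE => /andP[ts _].
  by case/orP => [/eqP ->//|]; rewrite mem_filter => /andP[su _]; exact: tlt_trans ts su.
apply: (@le_trans _ _ (vsum g (m1 ++ s :: m2))); last first.
  apply: vsum_le_curve_var => // t; rewrite mem_cat inE !mem_filter.
  by move=> /orP[/andP[_ /lC1[]//]|/orP[/eqP ->//|/andP[_ /lC2[]]]].
rewrite vsum_cat; apply: leeD; apply: vsum_subset => //.
- move: sm; rewrite -cat_rcons; exact: (subseq_sorted tlt_trans (prefix_subseq _ _)).
- move=> t tl; rewrite mem_rcons inE mem_filter tl andbT.
  have [_ /=] := lC1 _ tl; rewrite le_eqVlt val_eqE.
  by move=> /orP[->//|ts]; rewrite /tlt /= ts orbT.
- exact: (subseq_sorted tlt_trans (suffix_subseq _ _) sm).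
- move=> t tl; rewrite inE mem_filter tl andbT.
  have [_ /=] := lC2 _ tl; rewrite le_eqVlt eq_sym val_eqE.
  by move=> /orP[->//|ts]; rewrite /tlt /= ts orbT.
Qed.

(** Written as a sum because the variations may be infinite. When they are finite, it bounds
    distances by increments of the cumulative variation; it serves both [W1] and [emdist]. *)
Lemma curve_var_dist_le g C s u : C s -> C u -> val s < val u ->
  (curve_var dist g (C `&` [set t | (val t <= val s)%R]) + dist (g s) (g u) <=
   curve_var dist g (C `&` [set t | (val t <= val u)%R]))%E.
Proof.
move=> Cs Cu su.
rewrite [leRHS](@curve_var_split _ _ s); last by split => //=; exact: ltW.
apply: leeD.
  by apply: curve_varS => t [Ct] /= ts; do !split => //=; exact: le_trans (ltW su).
have <- : vsum g [:: s; u] = dist (g s) (g u) by rewrite vsum_cons2 vsum1 adde0.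
apply: vsum_le_curve_var; first by rewrite /= /tlt /= su.
by move=> t; rewrite !inE => /orP[/eqP ->|/eqP ->]; do !split => //=; exact: ltW.
Qed.

(** With a uniform gap, every time of the list can be moved to the right by less than [eta] without
    disturbing the order. *)
Lemma sorted_gap l : sorted tlt l ->
  exists2 eta : R, 0 < eta & sorted [rel t u : time T | val t + eta <= val u] l.
Proof.
elim: l => [|t [|u l] IH] /=; [by exists 1|by exists 1|].
move=> /andP[tu /IH [eta eta0 /= seta]].
exists (Num.min eta (val u - val t)); first by rewrite lt_min eta0 subr_gt0.
apply/andP; split; first by rewrite -lerBrDl ge_min lexx orbT.
apply: sub_path seta => a b /=; apply: le_trans; rewrite lerD2l.
by rewrite ge_min lexx.
Qed.

Lemma curve_var_dense g A E :
  (forall t, A t -> forall e eta : R, 0 < e -> 0 < eta ->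
    exists2 s, A s /\ E s &
      val t <= val s < val t + eta /\ (dist (g s) (g t) <= e%:E)%E) ->
  (curve_var dist g A <= curve_var dist g (A `&` E))%E.
Proof.
move=> HE; apply: curve_var_le => l sl lA; apply/lee_addgt0Pr => e e0.
have [eta eta0 seta] := sorted_gap sl.
(* Each time enters at most two terms of the sum, so moving all of them into [E] costs at most
   [(size l).*2] errors [e']; the successor keeps the denominator positive. *)
pose e' := e / ((size l).*2.+1)%:R.
have e'0 : 0 < e' by rewrite divr_gt0.
have /choice[f Hf] : forall t, exists s, A t -> [/\ A s, E s,
    val t <= val s < val t + eta & (dist (g s) (g t) <= e'%:E)%E].
  move=> t; have [At|nAt] := pselect (A t); last by exists t.
  by have [s [As Es] [ts d]] := HE t At e' eta e'0 eta0; exists s.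
have lf : (forall t, t \in l -> A t) ->
    (vsum g l <= vsum g (map f l) + (e' *+ (size l).*2)%:E)%E.
  elim: (l) => [|t [|u l' IH]] lA'; rewrite ?vsum_nil ?vsum1.
  - by rewrite adde0.
  - by rewrite /= ?vsum1 ?add0e lee_fin mulrn_wge0// ltW.
  rewrite !map_cons !vsum_cons2 -map_cons.
  have [_ _ _ dt] := Hf t (lA' t (mem_head _ _)).
  have [_ _ _ du] : [/\ A (f u), E (f u),
    val u <= val (f u) < val u + eta & (dist (g (f u)) (g u) <= e'%:E)%E].
    by apply/Hf/lA'; rewrite !inE eqxx orbT.
  have {}IH := IH (fun v vl => lA' v (mem_behead (s := t :: u :: l') vl)).
  have -> : (e' *+ (size [:: t, u & l']).*2)%:E =
     (e'%:E + e'%:E + (e' *+ (size (u :: l')).*2)%:E)%E.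
    by rewrite -!EFinD /= !doubleS !mulrS addrA.
  apply: (@le_trans _ _ ((e'%:E + dist (g (f t)) (g (f u)) + e'%:E) +
     (vsum g [seq f i | i <- u :: l'] + (e' *+ (size (u :: l')).*2)%:E))%E); last first.
    have E4 (a b c d : \bar R) :
        (b + c + (a + a + d) = (a + b + a) + (c + d))%E.
      by rewrite addeACA (addeC a b) (addeA b a a).
    by rewrite E4.
  apply: leeD => //.
  apply: le_trans (dtri _ (g (f u)) _) _; apply: leeD => //.
  apply: le_trans (dtri _ (g (f t)) _) _; apply: leeD => //.
  by rewrite dsym.
apply: le_trans (lf lA) _; apply: leeD.
  apply: vsum_le_curve_var.
    apply: (homo_sorted_in (P := [pred t | `[< A t >]]) _ _ seta).
      move=> t u /asboolP At /asboolP Au /= tu.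
      have [_ _ /andP[_ H1] _] := Hf t At; apply: (lt_le_trans H1).
      by apply: le_trans tu _; have [_ _ /andP[]] := Hf u Au.
    by apply/allP => t tl; apply/asboolP/lA.
  by move=> _ /mapP[t tl ->]; have [] := Hf t (lA t tl).
rewrite lee_fin /e' -mulr_natr -mulrA ler_piMr ?(ltW e0)//.
by rewrite mulrC ler_pdivrMr// mul1r ler_nat.
Qed.

Lemma time_of_real (x : R) : 0 < x < T -> exists t : time T, val t = x.
Proof. by move=> xT; exists (exist _ x xT). Qed.

Definition right_cont g := forall t (e : R), 0 < e ->
  exists2 eta : R, 0 < eta &
    forall s, val t <= val s < val t + eta -> (dist (g s) (g t) <= e%:E)%E.

Lemma cadlag_right_cont g : cadlag dist g -> right_cont g.
Proof.
move=> cg t e e0; have [/(_ e e0) + _] := cg t.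
move=> /nbhs_ballP[eta /= eta0 H]; exists eta => // s /andP[].
rewrite le_eqVlt => /orP[/eqP/val_inj <- _|ts se]; first by rewrite dxx lee_fin ltW.
apply/ltW/(H (val s)) => //.
by rewrite /ball/= distrC ger0_norm ?subr_ge0 ?(ltW ts)// ltrBlDl.
Qed.

(** Approximating points are always taken on the right, so openness on that side is enough; it holds
    for [[a, b)] as well as for [(a, b)]. *)
Definition right_open A := forall t, A t -> exists2 eta : R, 0 < eta &
  forall s, val t <= val s < val t + eta -> A s.

Lemma right_openT : right_open setT.
Proof. by move=> t _; exists 1. Qed.

Lemma right_open_itv (a b : R) : right_open [set t | a < val t < b].
Proof.
move=> t /= /andP[at' tb]; exists (b - val t); first by rewrite subr_gt0.
by move=> s /andP[ts]; rewrite addrC subrK => ->; rewrite (lt_le_trans at' ts).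
Qed.

Lemma right_open_itvco (a b : R) : right_open [set t | a <= val t < b].
Proof.
move=> t /= /andP[at' tb]; exists (b - val t); first by rewrite subr_gt0.
by move=> s /andP[ts]; rewrite addrC subrK => ->; rewrite (le_trans at' ts).
Qed.

Lemma time_right t (eta : R) : 0 < eta ->
  exists s : time T, val t < val s < val t + eta.
Proof.
move=> eta0; have /andP[t0 tT] := valP t.
have m0 : 0 < Num.min eta (T - val t) by rewrite lt_min eta0 subr_gt0.
have [s sE] : exists s : time T, val s = val t + Num.min eta (T - val t) / 2.
  apply: time_of_real; rewrite addr_gt0 ?divr_gt0//=.
  rewrite -ltrBrDl; apply: (@lt_le_trans _ _ (Num.min eta (T - val t))).
    by rewrite ltr_pdivrMr// ltr_pMr// ltr1n.
  by rewrite ge_min lexx orbT.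
exists s; rewrite sE ltrDl divr_gt0//= ltrD2l.
apply: (@lt_le_trans _ _ (Num.min eta (T - val t))).
  by rewrite ltr_pdivrMr// ltr_pMr// ltr1n.
by rewrite ge_min lexx.
Qed.

Lemma curve_var_rc_dense g A E : right_cont g -> right_open A ->
  (forall t (eta : R), A t -> 0 < eta ->
     exists2 s, E s & val t <= val s < val t + eta) ->
  curve_var dist g A = curve_var dist g (A `&` E).
Proof.
move=> rg rA dE; apply/eqP; rewrite eq_le; apply/andP; split; last by apply: curve_varS => t [].
apply: curve_var_dense => t At e eta e0 eta0.
have [eta1 eta10 H1] := rg t e e0; have [eta2 eta20 H2] := rA t At.
have m0 : 0 < Num.min eta (Num.min eta1 eta2) by rewrite !lt_min eta0 eta10.
have [s Es /andP[ts]] := dE t _ At m0.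
rewrite -ltrBlDl !lt_min !ltrBlDl => /and3P[h h1 h2].
by exists s; rewrite ?ts ?h; split=> //; [apply: H2|apply: H1]; rewrite ts.
Qed.

(** A modification off a null set agrees with [g] on a set that meets every right neighbourhood, and
    by right continuity the variation of [g] along that set is already the full one. *)
Lemma ess_varE g A : right_cont g -> right_open A ->
  ess_var dist g A = curve_var dist g A.
Proof.
move=> rg rA; apply/eqP; rewrite eq_le; apply/andP; split.
  apply: ereal_inf_lbound; exists g => //=.
  rewrite (_ : [set _ | _ in _] = set0); first exact: negligible_set0.
  by apply/seteqP; split=> // x [t [_ /(_ erefl)]].
apply: le_ereal_inf_tmp => _ [g' /= ng <-].
pose E := [set t | g' t = g t].
rewrite (@curve_var_rc_dense g A E)//; last first.
  move=> t eta At eta0; apply: contrapT => H.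
  have [eta1 eta10 H1] := rA t At.
  (* Otherwise [g'] and [g] would differ on a whole interval of length [d]; the caps in [d] keep
     that interval inside [A] and below [T]. *)
  have /andP[t0 tT] := valP t.
  pose d := Num.min (Num.min eta eta1) (T - val t).
  have d0 : 0 < d by rewrite !lt_min eta0 eta10 subr_gt0.
  have sub : `]val t, val t + d[%classic `<=` [set val t | t in [set t | A t /\ g' t <> g t]].
    move=> x /=; rewrite in_itv/= => /andP[tx].
    rewrite -ltrBlDl !lt_min !ltrBlDl => /andP[/andP[xe xe1]].
    rewrite addrC subrK => xT.
    have [s sE] := @time_of_real x (introT andP (conj (lt_trans t0 tx) xT)).
    exists s => //=; split.
      by apply: H1; rewrite sE (ltW tx).
    by move=> gs; apply: H; exists s; rewrite // sE (ltW tx).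
  case: ng => N [mN N0 sN].
  have N1 : (@lebesgue_measure R) N = 0%E := N0.
  have : ((@lebesgue_measure R) `]val t, (val t + d)%R[%classic <= (@lebesgue_measure R) N)%E.
    by apply: le_measure; rewrite ?inE//; exact: subset_trans sub sN.
  rewrite N1 lebesgue_measure_itv /= lte_fin ltrDl d0 -EFinB lee_fin addrC addKr.
  by rewrite leNgt d0.
rewrite (@eq_curve_var g g') => [|t [_ ->]//].
by apply: curve_varS => t [].
Qed.

(** * The variation measure as a Lebesgue-Stieltjes measure *)

Section bounded_variation.
Context (g : time T -> Y) (rg : right_cont g).
Context (fg : (curve_var dist g setT < +oo)%E).

Let cv A : R := fine (curve_var dist g A).

Let cvE A : curve_var dist g A = (cv A)%:E.
Proof.
rewrite fineK// ge0_fin_numE ?curve_var_ge0//.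
by apply: le_lt_trans fg; exact: curve_varS.
Qed.

Let cvS A B : A `<=` B -> cv A <= cv B.
Proof. by move=> AB; rewrite -lee_fin -!cvE curve_varS. Qed.

Let cv_ge0 A : 0 <= cv A.
Proof. by rewrite -lee_fin -cvE curve_var_ge0. Qed.

Let cv_split C s : C s ->
  cv C = cv (C `&` [set t | val t <= val s]) + cv (C `&` [set t | val s <= val t]).
Proof. by move=> Cs; apply: EFin_inj; rewrite EFinD -!cvE; exact: curve_var_split. Qed.

Let cv_adherent A (e : R) : 0 < e -> exists l,
  [/\ sorted tlt l, (forall t, t \in l -> A t) & ((cv A - e)%:E < vsum g l)%E].
Proof.
move=> e0; have := @ub_ereal_sup_adherent R [set vsum g l | l in
   [set l | sorted tlt l /\ forall t, t \in l -> A t]] e e0.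
have -> : ereal_sup [set vsum g l | l in
   [set l | sorted tlt l /\ forall t, t \in l -> A t]] = (cv A)%:E by rewrite -cvE.
by move=> /(_ isT)[_ [l [sl lA] <-] H]; exists l.
Qed.

(** The variation over [(0, x]], extended to the whole line: 0 for [x <= 0] and constant from [T]
    on. *)
Definition cum_var (x : R) : R := cv [set t | val t <= x].

Lemma cum_var_nd : nondecreasing cum_var.
Proof. by move=> x y xy; apply: cvS => t /= /le_trans; apply. Qed.

Lemma cum_var_le0 (x : R) : x <= 0 -> cum_var x = 0.
Proof.
move=> x0; apply/eqP; rewrite eq_le cv_ge0 andbT -lee_fin -cvE.
apply: curve_var_le => -[|t l] _ lA; first by rewrite vsum_nil.
have /= := lA t (mem_head _ _); have /andP[t0 _] := valP t.
by rewrite leNgt (le_lt_trans x0 t0).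
Qed.

(** Take a nearly optimal partition of the times from [x] on and insert a time [v] right after [x].
    By right continuity the step from [x] to [v] costs at most [e / 2], so almost all of the
    variation lies beyond [v] and little is left between [x] and [v]. *)
Let cum_var_right (x : R) (e : R) : 0 < e -> exists2 y, x < y & cum_var y <= cum_var x + e.
Proof.
move=> e0; have [x0|x0] := leP x 0.
  (* For [x <= 0] there is no time at [x] to start from. The first time [u] of a partition nearly
     optimal for the whole interval does the job, since that partition lies in the times from [u]
     on. *)
  have [[|u l] [sl lA H]] := @cv_adherent setT e e0.
    exists (x + 1); rewrite ?ltrDl// (cum_var_le0 x0) add0r.
    rewrite vsum_nil lte_fin in H.
    by apply: le_trans (@cvS _ setT _) _ => //; lra.
  exists (val u); first by case/andP: (valP u) => u0 _; exact: le_lt_trans u0.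
  rewrite (cum_var_le0 x0) add0r.
  have := @cv_split setT u I; rewrite !setTI => E.
  have : (vsum g (u :: l) <= (cv [set t | val u <= val t])%:E)%E.
    rewrite -cvE; apply: vsum_le_curve_var => // t.
    rewrite inE => /orP[/eqP ->/=//|tl /=].
    by move: sl => /= /(order_path_min tlt_trans)/allP/(_ _ tl)/ltW.
  move=> /(lt_le_trans H); rewrite lte_fin E /cum_var; lra.
have [xT|xT] := leP T x.
  exists (x + 1); rewrite ?ltrDl//; apply: (@le_trans _ _ (cum_var x)); last lra.
  by apply: cvS => t _ /=; case/andP: (valP t) => _ /ltW/le_trans; apply.
have [s sE] := @time_of_real x (introT andP (conj x0 xT)).
have Es := @cv_split setT s I; rewrite !setTI in Es.
have [l0 [sl0 lA0 H0]] := @cv_adherent [set t | val s <= val t] (e / 2) (divr_gt0 e0 (ltr0Sn _ _)).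
have [l sl H] : exists2 l, sorted tlt (s :: l) &
    ((cv [set t | (val s <= val t)%R] - e / 2)%:E < vsum g (s :: l))%E.
  have sl : sorted tlt (s :: [seq t <- l0 | tlt s t]).
    exact: (subseq_sorted tlt_trans (suffix_subseq _ _) (sorted_pivot s sl0)).
  exists [seq t <- l0 | tlt s t] => //; apply: (lt_le_trans H0).
  apply: vsum_subset => // t tl; rewrite inE mem_filter tl andbT.
  have /= := lA0 _ tl; rewrite le_eqVlt eq_sym val_eqE.
  by move=> /orP[->//|ts]; rewrite /tlt /= ts orbT.
have xs : cum_var x = cv [set t | val t <= val s] by rewrite /cum_var sE.
case: l => [|u l] in sl H.
  exists (x + 1); rewrite ?ltrDl// xs; apply: le_trans (@cvS _ setT _) _ => //.
  rewrite vsum1 lte_fin in H; rewrite Es; lra.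
have /andP[su ul] : tlt s u && path tlt u l by [].
have [eta eta0 He] := rg s (divr_gt0 e0 (ltr0Sn _ 1)).
have m0 : 0 < Num.min eta (val u - val s) by rewrite lt_min eta0 subr_gt0.
have [v /andP[sv]] := time_right s m0.
rewrite -ltrBlDl lt_min !ltrBlDl => /andP[ve]; rewrite addrC subrK => vu.
exists (val v); first by rewrite -sE.
have Ev := @cv_split setT v I; rewrite !setTI in Ev.
rewrite xs /cum_var.
have : (vsum g (s :: u :: l) <= (e / 2)%:E + (cv [set t | (val v <= val t)%R])%:E)%E.
  apply: (@le_trans _ _ (vsum g [:: s, v, u & l])).
    apply: vsum_subseq.
    exact: (cat_subseq (subseq_refl [:: s]) (subseq_cons (u :: l) v)).
  rewrite vsum_cons2 -cvE; apply: leeD.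
    by rewrite dsym; apply: He; rewrite ltW.
  apply: vsum_le_curve_var; first by rewrite /= ul andbT.
  move=> t; rewrite !inE => /or3P[/eqP ->/=//|/eqP ->/=|tl /=]; first exact: ltW.
  apply/ltW/(lt_trans vu).
  by move: ul => /= /(order_path_min tlt_trans)/allP/(_ _ tl).
move=> /(lt_le_trans H); rewrite -EFinD lte_fin; lra.
Qed.

Lemma cum_var_rc : right_continuous cum_var.
Proof.
move=> x; apply/cvgrPdist_le => e e0.
have [y xy Hy] := cum_var_right x e0.
near=> z.
have xz : x < z by near: z; exact: nbhs_right_gt.
have zy : z <= y by near: z; exact: nbhs_right_le.
rewrite ler0_norm ?subr_le0 ?cum_var_nd ?(ltW xz)// opprB lerBlDl.
by apply: le_trans Hy; exact: cum_var_nd.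
Unshelve. all: by end_near. Qed.

HB.instance Definition _ :=
  isCumulative.Build R _ R cum_var cum_var_nd cum_var_rc.

Let ls := lebesgue_stieltjes_measure cum_var.

Let ls_oc (a b : R) : a <= b -> ls `]a, b]%classic = (cum_var b - cum_var a)%:E.
Proof.
move=> ab; rewrite /ls /lebesgue_stieltjes_measure /measure_extension/=.
rewrite measurable_mu_extE/=; last exact: is_ocitv.
by rewrite wlength_itv_bnd.
Qed.

Let mls := mrestr ls (measurable_itv `]0, T[).

Let mls_fin : fin_num_fun mls.
Proof.
move=> A mA; rewrite ge0_fin_numE// /mls /mrestr.
apply: (@le_lt_trans _ _ (ls `]0, `|T|]%classic)).
  apply: le_measure; rewrite ?inE//; first exact: measurableI.
  move=> x [_] /=; rewrite !in_itv/= => /andP[-> xT]/=.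
  exact: le_trans (ltW xT) (ler_norm _).
by rewrite ls_oc// ltry.
Qed.

HB.instance Definition _ := Measure.on mls.
HB.instance Definition _ := Measure_isFinite.Build _ _ _ mls mls_fin.

(** For [0 < a < T] the increment is the variation over [[a, y]]. Right continuity at [a] allows the
    endpoint to be dropped, so a jump at [a] is not counted. *)
Let cum_var_le_itv (a y b : R) : 0 <= a -> a < y -> y < b ->
  cum_var y - cum_var a <= cv [set t | a < val t < b].
Proof.
move=> a0 ay yb; move: a0; rewrite le_eqVlt => /orP[/eqP a0|a0].
  rewrite (cum_var_le0 (_ : a <= 0)) ?subr0 -?a0//; apply: cvS => t /= ty.
  by rewrite (le_lt_trans ty yb) andbT; case/andP: (valP t).
have [aT|Ta] := ltP a T; last first.
  rewrite (_ : cum_var y = cum_var a) ?subrr//; apply/eqP; rewrite eq_le.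
  rewrite (cum_var_nd (ltW ay)) andbT; apply: cvS => t _ /=.
  by case/andP: (valP t) => _ /ltW tT; exact: le_trans Ta.
have [s sE] := @time_of_real a (introT andP (conj a0 aT)).
have := @cv_split [set t | val t <= y] s; rewrite /= sE (ltW ay) => /(_ isT) E.
rewrite /cum_var E.
have -> : [set t : time T | val t <= y] `&` [set t | val t <= a] = [set t | val t <= a].
  by apply/seteqP; split => [t []//|t /= ta]; split => //=; exact: le_trans (ltW ay).
rewrite addrAC subrr add0r.
apply: (@le_trans _ _ (cv [set t | a <= val t < b])).
  by apply: cvS => t [/= ty ->]/=; exact: le_lt_trans yb.
rewrite -lee_fin -!cvE (@curve_var_rc_dense g _ [set t | a < val t] rg (@right_open_itvco _ _)).
  by apply: curve_varS => t [/= /andP[_ ->] ->].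
move=> t eta /andP[at' _] eta0; have [s' /andP[ts se]] := time_right t eta0.
by exists s'; [exact: le_lt_trans ts|rewrite (ltW ts)].
Qed.

Let cum_var_ge_vsum (a y : R) l : 0 <= a -> a <= y -> sorted tlt l ->
  (forall t, t \in l -> a < val t <= y) ->
  (vsum g l <= (cum_var y - cum_var a)%:E)%E.
Proof.
move=> a0 ay sl lA; move: a0; rewrite le_eqVlt => /orP[/eqP a0|a0].
  rewrite (cum_var_le0 (_ : a <= 0)) ?subr0 -?a0// -cvE.
  by apply: vsum_le_curve_var => // t /lA/andP[].
have [aT|Ta] := ltP a T; last first.
  case: l sl lA => [_ _|t l _ /(_ t (mem_head _ _)) /andP[at' _]].
    by rewrite vsum_nil lee_fin subr_ge0 cum_var_nd.
  case/andP: (valP t) => _ /(lt_trans at').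
  by rewrite ltNge Ta.
have [s sE] := @time_of_real a (introT andP (conj a0 aT)).
have := @cv_split [set t | val t <= y] s; rewrite /= sE ay => /(_ isT) E.
rewrite /cum_var E.
have -> : [set t : time T | val t <= y] `&` [set t | val t <= a] = [set t | val t <= a].
  by apply/seteqP; split => [t []//|t /= ta]; split => //=; exact: le_trans ay.
rewrite addrAC subrr add0r -cvE; apply: vsum_le_curve_var => // t /lA /andP[at' ty].
by split => //=; exact: ltW.
Qed.

Let mls_itv (a b : R) : 0 <= a -> a < b -> b <= T ->
  mls `]a, b[%classic = curve_var dist g [set t | a < val t < b].
Proof.
move=> a0 ab bT.
have -> : mls `]a, b[%classic = ls `]a, b[%classic.
  rewrite /mls /mrestr; congr (ls _); apply/setIidPl => x /=.
  by rewrite !in_itv/= => /andP[ax xb]; rewrite (le_lt_trans a0 ax) (lt_le_trans xb bT).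
have bn0 n : 0 < (b - a) / n.+2%:R by rewrite divr_gt0// subr_gt0.
(* The cumulative function gives the mass of half-open intervals, so []a, b[] is exhausted by the
   []a, bn n]]; the denominator [n.+2] keeps [bn n] strictly between [a] and [b]. *)
pose bn n := b - (b - a) / n.+2%:R.
have abn n : a < bn n.
  rewrite /bn ltrBrDl -ltrBrDr ltr_pdivrMr// ltr_pMr ?subr_gt0//.
  by rewrite ltr1n.
have bnb n : bn n < b by rewrite /bn ltrBlDr ltrDl.
have bn_nd n m : (n <= m)%N -> bn n <= bn m.
  move=> nm; rewrite /bn lerB// ler_pM2l ?subr_gt0//.
  by rewrite lef_pV2 ?posrE// ler_nat.
have bn_lim x : x < b -> exists n, x <= bn n.
  move=> xb; exists (Num.truncn ((b - a) / (b - x))).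
  rewrite /bn lerBrDr -lerBrDl ler_pdivrMr// mulrC -ler_pdivrMr ?subr_gt0//.
  by apply/ltW/(lt_le_trans (truncnS_gt _)); rewrite ler_nat.
have cvgm : ls `]a, bn n]%classic @[n --> \oo] --> ls `]a, b[%classic.
  have -> : `]a, b[%classic = \bigcup_n `]a, bn n]%classic.
    apply/seteqP; split => [x /=|x [n _] /=]; rewrite !in_itv/=.
      by move=> /andP[ax /bn_lim[n xn]]; exists n => //=; rewrite in_itv/= ax.
    by move=> /andP[-> xn]; exact: le_lt_trans xn _.
  apply: nondecreasing_cvg_mu => //; first exact: bigcup_measurable.
  move=> n m nm; apply/subsetPset => x /=; rewrite !in_itv/= => /andP[->] /le_trans; apply.
  exact: bn_nd.
apply/eqP; rewrite eq_le; apply/andP; split.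
  rewrite -(cvg_lim _ cvgm)//; apply: lime_le; first by apply/cvg_ex; eexists; exact: cvgm.
  apply: nearW => n; rewrite ls_oc ?(ltW (abn n))// cvE lee_fin.
  exact: cum_var_le_itv.
apply: curve_var_le => l sl lA.
have [n ln] : exists n, forall t, t \in l -> val t <= bn n.
  elim: l lA {sl} => [|t l IH] lA; first by exists 0%N.
  have [n1 H1] := IH (fun u ul => lA u (mem_behead (s := t :: l) ul)).
  have /andP[_ /bn_lim[n2 H2]] := lA t (mem_head _ _).
  exists (maxn n1 n2) => u; rewrite inE => /orP[/eqP ->|/H1 /le_trans]; last first.
    by apply; apply: bn_nd; rewrite leq_maxl.
  by apply: le_trans H2 _; apply: bn_nd; rewrite leq_maxr.
apply: (@le_trans _ _ (ls `]a, bn n]%classic)).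
  rewrite ls_oc ?(ltW (abn n))//; apply: cum_var_ge_vsum => // [|t tl]; first exact: ltW.
  by rewrite ln// andbT; case/andP: (lA t tl).
apply: le_measure; rewrite ?inE// => x /=; rewrite !in_itv/= => /andP[->].
by move=> /le_lt_trans; apply.
Qed.

Lemma variation_measure_exists : exists m, is_variation_measure dist g m.
Proof.
exists mls; split.
  rewrite -[LHS]/(ls (~` _ `&` _)) setICl.
  exact: (measure0 (lebesgue_stieltjes_measure cum_var)).
by move=> a b a0 ab bT; rewrite ess_varE;
  [exact: mls_itv|exact: rg|exact: right_open_itv].
Qed.

End bounded_variation.

Lemma bv_curveE g : bv_curve dist g <->
  cadlag dist g /\ (curve_var dist g setT < +oo)%E.
Proof.
by rewrite /bv_curve; split=> -[cg]; rewrite ess_varE//; [exact: cadlag_right_cont|exact: right_openT|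
  exact: cadlag_right_cont|exact: right_openT].
Qed.

Lemma itv0T : [set t : time T | 0 < val t < T] = setT.
Proof. by apply/seteqP; split => // t _; exact: valP t. Qed.

Lemma variation_measure_itv g (a b : R) : bv_curve dist g ->
  0 <= a -> a < b -> b <= T ->
  variation_measure dist g `]a, b[%classic = curve_var dist g [set t | a < val t < b].
Proof.
move=> /bv_curveE[cg fg] a0 ab bT.
have rg := cadlag_right_cont cg.
rewrite /variation_measure; case: pselect => [h|/(_ (variation_measure_exists rg fg))//].
have [_ ->//] := projT2 (cid h).
by rewrite ess_varE//; exact: right_open_itv.
Qed.

Lemma variation_measureC g : variation_measure dist g (~` `]0, T[%classic) = 0%E.
Proof.
rewrite /variation_measure; case: pselect => // h.
by have [->] := projT2 (cid h).
Qed.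

(** A finite measure taking the required value on []0, T[] would bound the essential variation.
    Knowing the value off BV is needed for measurability in [g] on the whole space of cadlag
    curves. *)
Lemma variation_measure0 g : 0 < T -> cadlag dist g -> ~ bv_curve dist g ->
  variation_measure dist g = mzero.
Proof.
move=> T0 cg ng; rewrite /variation_measure; case: pselect => // h; exfalso.
apply: ng; split => //; have [m [_ /(_ 0 T (lexx _) T0 (lexx _))]] := h.
by rewrite itv0T => <-; rewrite -ge0_fin_numE// fin_num_measure.
Qed.

End variation.

(** * Gluing couplings, and the Wasserstein distance *)

Section pushforward_law.
Context (R : realType) d1 d2 (S1 : measurableType d1) (S2 : measurableType d2).
Context (P : probability S1 R) (f : S1 -> S2) (mf : measurable_fun setT f).

#[local] HB.instance Definition _ := isMeasurableFun.Build _ _ _ _ f mf.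

Lemma law_exists : exists Q : probability S2 R,
  (forall B, Q B = P (f @^-1` B)) /\
  (forall h : S2 -> \bar R, measurable_fun setT h -> (forall x, 0 <= h x)%E ->
    (\int[Q]_x h x = \int[P]_x h (f x))%E).
Proof.
exists (distribution P f); split => // h mh h0.
by rewrite ge0_integral_distribution.
Qed.

End pushforward_law.

Lemma measure_probability (R : realType) d (S : measurableType d)
    (m : {measure set S -> \bar R}) : m setT = 1%E ->
  exists Q : probability S R, forall A, Q A = m A.
Proof.
move=> m1; exists (mnormalize m (dirac point)) => A.
by rewrite /= /mnormalize m1 onee_eq0 /= invr1 mule1.
Qed.

Lemma integral_cst_le (R : realType) d (S : measurableType d) (P : probability S R)
  (k : \bar R) : (\int[P]_x cst k x <= k)%E.
Proof.
rewrite integral_cst//; have PT : P setT = 1%E := probability_setT P.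
by rewrite [X in (_ * X)%E](_ : _ = 1%E) ?mule1.
Qed.

Section metric_measure.
Context (R : realType) (X : completeMetricType R) (hX : separable_space X).

Lemma dense_seq_exists : exists xs : nat -> X,
  forall (x : X) (e : R), 0 < e -> exists n, mdist x (xs n) < e.
Proof.
have [S /countable_injP[f injf] dS] := hX.
exists (fun n => xget point [set s | S s /\ f s = n]) => x e e0.
have [s [xs Ss]] : (ball x e)^° `&` S !=set0.
  apply: dS; last exact: open_interior.
  by exists x; exact: nbhsx_ballx.
exists (f s); case: xgetP => [y _ [Sy fys]|/(_ s)]; last first.
  by move=> /(_ (conj Ss erefl)).
have -> : y = s by apply: injf; rewrite ?inE.
by have := interior_subset xs; rewrite ballEmdist.
Qed.

Lemma open_mdist_lt (x : X) (r : R) : open [set y | mdist y x < r].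
Proof.
rewrite openE => y /= yr; rewrite /interior.
have e0 : 0 < r - mdist y x by rewrite subr_gt0.
apply: filterS (nbhsx_ballx y _ e0) => z; rewrite ballEmdist/= => yz.
apply: le_lt_trans (metric_triangle z y x) _.
by rewrite metric_sym -ltrBrDr.
Qed.

Lemma open_ballP (U : set X) : open U -> forall x, U x ->
  exists2 e : R, 0 < e & forall y, mdist x y < e -> U y.
Proof.
rewrite openE => oU x /oU; rewrite /interior => /nbhs_ballP[e /= e0 H].
by exists e => // y xy; apply: H; rewrite ballEmdist.
Qed.

Lemma measurable_open (U : set X) : open U -> measurable (U : set (borel X)).
Proof. exact: sub_gen_smallest. Qed.

Section measurable_maps.
Context d (S : measurableType d).
Implicit Types f g : S -> borel X.

Lemma measurable_mdistl f (x : X) : measurable_fun setT f ->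
  measurable_fun setT (fun s => mdist (f s : X) x).
Proof.
move=> mf; apply: (measurability _ (RGenInftyO.measurableE R)).
move=> _ [_ [r ->] <-]; rewrite setTI.
rewrite (_ : _ @^-1` _ = f @^-1` [set y : X | mdist y x < r]); last first.
  by apply/seteqP; split => s /=; rewrite in_itv.
rewrite -[X in measurable X]setTI; apply: mf => //.
apply: measurable_open; exact: open_mdist_lt.
Qed.

(** A distance is less than [r] exactly when the detour through some point of a dense sequence is;
    this reduces two varying points to countably many fixed ones. *)
Lemma measurable_mdist f g : measurable_fun setT f -> measurable_fun setT g ->
  measurable_fun setT (fun s => mdist (f s : X) (g s : X)).
Proof.
move=> mf mg; have [xs xsP] := dense_seq_exists.
apply: (measurability _ (RGenInftyO.measurableE R)).
move=> _ [_ [r ->] <-]; rewrite setTI.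
rewrite (_ : _ @^-1` _ = \bigcup_n
  ((fun s => mdist (f s : X) (xs n) + mdist (g s : X) (xs n)) @^-1` `]-oo, r[%classic)); last first.
  apply/seteqP; split => s /=; rewrite ?in_itv/=.
    move=> fg; have e0 : 0 < (r - mdist (f s : X) (g s : X)) / 2.
      by rewrite divr_gt0// subr_gt0.
    have [n Hn] := xsP (g s) _ e0; exists n => //=; rewrite in_itv/=.
    have := metric_triangle (f s : X) (g s) (xs n); lra.
  move=> [n _ /=]; rewrite in_itv/= => H.
  by have := metric_triangle (f s : X) (xs n) (g s); rewrite (metric_sym (xs n)); lra.
apply: bigcupT_measurable => n; rewrite -[X in measurable X]setTI.
have : measurable_fun setT (fun s => mdist (f s : X) (xs n) + mdist (g s : X) (xs n)).
  by apply: measurable_funD; exact: measurable_mdistl.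
by apply => //; exact: measurable_itv.
Qed.

Lemma measurable_emdist f g : measurable_fun setT f -> measurable_fun setT g ->
  measurable_fun setT (fun s => emdist (f s : X) (g s : X)).
Proof. by move=> mf mg; apply/measurable_EFinP; exact: measurable_mdist. Qed.

(** By separability an open set is the countable union of the balls of radius [1 / k.+1] around the
    [xs n] that it contains. Testing distances to points makes measurability stable under pointwise
    limits. *)
Lemma measurable_to_borel (f : S -> X) :
  (forall x : X, measurable_fun setT (fun s => mdist (f s) x)) ->
  measurable_fun setT (f : S -> borel X).
Proof.
move=> mf; apply: (@measurability _ _ S (borel X) setT f (@open X)) => //.
move=> _ [U oU <-]; rewrite setTI.
have [xs xsP] := dense_seq_exists.
pose I (n k : nat) := [set s | mdist (f s) (xs n) < k.+1%:R^-1 /\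
  forall y, mdist (xs n) y < k.+1%:R^-1 -> U y].
rewrite (_ : _ @^-1` _ = \bigcup_n \bigcup_k I n k); last first.
  apply/seteqP; split => s /=.
    move=> /(open_ballP oU)[e e0 He].
    have [k Hk] : exists k, k.+1%:R^-1 < e / 2.
      exists (Num.truncn (e / 2)^-1).
      by rewrite invf_plt ?posrE ?divr_gt0// truncnS_gt.
    have k0 : 0 < k.+1%:R^-1 :> R by rewrite invr_gt0.
    have [n Hn] := xsP (f s) _ k0; exists n => //; exists k => //; split=> // y yk.
    apply: He; apply: le_lt_trans (metric_triangle _ (xs n) _) _.
    by rewrite (splitr e) ltrD// (lt_trans _ Hk).
  by move=> [n _ [k _ [fs]]]; apply; rewrite metric_sym.
apply: bigcupT_measurable => n; apply: bigcupT_measurable => k.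
have [h|h] := pselect (forall y, mdist (xs n) y < k.+1%:R^-1 -> U y); last first.
  rewrite (_ : I n k = set0)//.
  by apply/seteqP; split=> // s [_ /h].
rewrite (_ : I n k = (fun s => mdist (f s) (xs n)) @^-1` `]-oo, k.+1%:R^-1[%classic); last first.
  by apply/seteqP; split => s; rewrite /I /= in_itv/=; [case|].
by rewrite -[X in measurable X]setTI; apply: mf.
Qed.

Lemma cvg_mdist (u : nat -> X) (y x : X) :
  (mdist (u n) y @[n --> \oo] --> (0 : R)) ->
  mdist (u n) x @[n --> \oo] --> mdist y x.
Proof.
move=> uy; apply/cvgrPdist_le => e e0.
move/cvgrPdist_le : uy => /(_ e e0); apply: filterS => n.
rewrite sub0r normrN ger0_norm ?mdist_ge0// => un.
have := metric_triangle (u n) y x; have := metric_triangle y (u n) x.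
rewrite (metric_sym y (u n)) => h1 h2; rewrite ler_norml; lra.
Qed.

Lemma measurable_lim (u : nat -> S -> X) (f : S -> X) :
  (forall n, measurable_fun setT (u n : S -> borel X)) ->
  (forall s, mdist (u n s) (f s) @[n --> \oo] --> (0 : R)) ->
  measurable_fun setT (f : S -> borel X).
Proof.
move=> mu uf; apply: measurable_to_borel => x.
apply: (@measurable_fun_cvg _ _ _ _ (fun n s => mdist (u n s) x)).
  by move=> n; exact: measurable_mdistl (mu n).
by move=> s _; exact: cvg_mdist (uf s).
Qed.

End measurable_maps.

(** One-sided bounds suffice because total masses agree: the bound on the open sets [O n] reverses
    on their complements, and these closed sets increase to [U]. *)
Lemma open_le_measure_eq (m1 m2 : probability (borel X) R) :
  (forall U : set X, open U -> (m1 U <= m2 U)%E) ->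
  forall B : set (borel X), measurable B -> m1 B = m2 B.
Proof.
move=> H; suff E (U : set X) : open U -> m1 U = m2 U.
  move=> B mB; apply: (@measure_unique _ R (borel X) (@open X) (fun=> setT)) => //.
  - by move=> A A' oA oA'; exact: openI.
  - by move=> _; exact: openT.
  - by rewrite bigcup_const//; exists 0%N.
  - move=> k; exact: (le_lt_trans (probability_le1 m1 measurableT) (ltry _)).
move=> oU; apply/eqP; rewrite eq_le H//=.
pose O n := [set x : X | exists2 y, ~ U y & mdist x y < n.+1%:R^-1].
have oO n : open (O n).
  rewrite openE => x [y Uy xy]; rewrite /interior.
  apply: filterS (open_nbhs_nbhs (conj (open_mdist_lt y n.+1%:R^-1) xy)).
  by move=> z /= zy; exists y.
have mO n : measurable (O n : set (borel X)) by apply: measurable_open; exact: oO.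
have mU := measurable_open oU.
have UE : U = \bigcup_n ~` O n.
  apply/seteqP; split => [x Ux|x [n _ Onx]].
    have [e e0 He] := open_ballP oU Ux.
    exists (Num.truncn e^-1) => // -[y Uy xy]; apply: Uy; apply: He.
    apply: (lt_trans xy); rewrite invf_plt ?posrE//; exact: truncnS_gt.
  by apply: contrapT => Ux; apply: Onx; exists x; rewrite // mdistxx invr_gt0.
have cv (m : probability (borel X) R) : m (~` O n) @[n --> \oo] --> m U.
  rewrite [in X in _ --> X]UE; apply: nondecreasing_cvg_mu.
  - by move=> n; exact: measurableC.
  - by rewrite -UE.
  - move=> i j ij; apply/subsetPset; apply: subsetC => x [y Uy xy].
    by exists y => //; apply: lt_le_trans xy _; rewrite lef_pV2 ?posrE// ler_nat ltnS.
rewrite -(cvg_lim _ (cv m1))// -(cvg_lim _ (cv m2))//.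
apply: lee_lim.
- by apply/cvg_ex; eexists; exact: cv.
- by apply/cvg_ex; eexists; exact: cv.
apply: nearW => n; rewrite !probability_setC//.
by apply: leeB => //; exact: H.
Qed.

(** The points at distance more than [r] from the complement of [U]: an error of at most [r] cannot
    lead out of [U]. The radius [e] strictly above [r] makes the set open. *)
Definition inner (U : set X) (r : R) : set X :=
  [set x | exists2 e, r < e & forall y, mdist x y < e -> U y].

Lemma open_inner U r : open (inner U r).
Proof.
rewrite openE => x [e re He]; rewrite /interior.
have e0 : 0 < (e - r) / 2 by rewrite divr_gt0// subr_gt0.
apply: filterS (nbhsx_ballx x _ e0) => z; rewrite ballEmdist/= => xz.
exists ((e + r) / 2); first lra.
by move=> y zy; apply: He; have := metric_triangle x z y; lra.
Qed.

Lemma inner_sub U r : 0 <= r -> inner U r `<=` U.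
Proof. by move=> r0 x [e re]; apply; rewrite mdistxx (le_lt_trans r0). Qed.

(** Half of the portmanteau theorem. On [G], a limit in the open set [inner U r] forces [u n] to be
    there eventually, so [f] hits [inner U r] with probability at most [m U]; then [r] tends to 0
    and [open_le_measure_eq] concludes. The shrunken sets in the hypothesis leave room for [u n] to
    have only approximately the law [m]. *)
Lemma law_limit d (S : measurableType d) (P : probability S R)
    (u : nat -> S -> X) (f : S -> X) (G : set S) (m : probability (borel X) R) :
  (forall n, measurable_fun setT (u n : S -> borel X)) ->
  measurable_fun setT (f : S -> borel X) ->
  measurable G -> P (~` G) = 0%E ->
  (forall s, G s -> mdist (u n s) (f s) @[n --> \oo] --> (0 : R)) ->
  (forall U (r e : R), open U -> 0 < r -> 0 < e ->
     \forall n \near \oo, (P (u n @^-1` inner U r) <= m U + e%:E)%E) ->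
  forall B : set (borel X), measurable B -> P (f @^-1` B) = m B.
Proof.
move=> mu mf mG PG uf H.
have [Q [QE _]] := law_exists P mf.
move=> B mB; rewrite -QE; apply: open_le_measure_eq => // U oU.
have mpre (g : S -> X) V : measurable_fun setT (g : S -> borel X) -> open V ->
    measurable (g @^-1` V).
  by move=> mg oV; rewrite -[X in measurable X]setTI; apply: mg => //; exact: measurable_open.
have main r : 0 < r -> (P (f @^-1` inner U r) <= m U)%E.
  move=> r0; apply/lee_addgt0Pr => e e0.
  pose E N := \bigcap_(n in [set n | (N <= n)%N]) (u n @^-1` inner U r).
  have mE N : measurable (E N).
    apply: bigcap_measurable; first by exists N => /=.
    by move=> k _; exact/mpre/open_inner.
  have sub : f @^-1` inner U r `<=` \bigcup_N E N `|` ~` G.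
    move=> s /= fs; have [Gs|nGs] := pselect (G s); last by right.
    left; have [e' e'0 He'] := open_ballP (open_inner U r) fs.
    have /cvgrPdist_lt /(_ e' e'0) [N _ HN] := uf s Gs.
    exists N => // n /= Nn; apply: He'.
    by have := HN n Nn; rewrite /= sub0r normrN ger0_norm ?mdist_ge0// metric_sym.
  apply: (@le_trans _ _ (P (\bigcup_N E N `|` ~` G))).
    apply: le_measure; rewrite ?inE//; first exact/mpre/open_inner.
    by apply: measurableU; [exact: bigcupT_measurable|exact: measurableC].
  apply: (@le_trans _ _ (P (\bigcup_N E N))).
    rewrite -[leRHS]adde0 -PG; apply: measureU2; first exact: bigcupT_measurable.
    exact: measurableC.
  have cv : P (E N) @[N --> \oo] --> P (\bigcup_N E N).
    apply: nondecreasing_cvg_mu => //; first exact: bigcupT_measurable.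
    by move=> i j ij; apply/subsetPset => s Es n /= jn; apply: Es => /=; exact: leq_trans jn.
  rewrite -(cvg_lim _ cv)//; apply: lime_le; first by apply/cvg_ex; eexists; exact: cv.
  apply: filterS (H U r e oU r0 e0) => n; apply: le_trans.
  apply: le_measure; rewrite ?inE//; first exact/mpre/open_inner.
  by move=> s; apply => /=.
have UE : U = \bigcup_k inner U k.+1%:R^-1.
  apply/seteqP; split => [x Ux|x [n _]]; last exact: inner_sub.
  have [e e0 He] := open_ballP oU Ux.
  exists (Num.truncn e^-1) => //; exists e => //.
  by rewrite invf_plt ?posrE//; exact: truncnS_gt.
have cv : Q (inner U k.+1%:R^-1) @[k --> \oo] --> Q U.
  rewrite [in X in _ --> X]UE; apply: nondecreasing_cvg_mu.
  - by move=> n; apply: measurable_open; exact: open_inner.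
  - by rewrite -UE; exact: measurable_open.
  - move=> i j ij; apply/subsetPset => x [e re He]; exists e => //.
    by apply: le_lt_trans re; rewrite lef_pV2 ?posrE// ler_nat ltnS.
rewrite -(cvg_lim _ cv)//; apply: lime_le; first by apply/cvg_ex; eexists; exact: cv.
by apply: nearW => k; rewrite QE; exact: main.
Qed.


Definition cell (xs : nat -> X) (e : R) (i : nat) : set X :=
  [set x | mdist x (xs i) < e /\ forall j, (j < i)%N -> e <= mdist x (xs j)].

Section cells.
Context (xs : nat -> X).
Hypothesis xsP : forall (x : X) (e : R), 0 < e -> exists n, mdist x (xs n) < e.
Context (e : R) (e0 : 0 < e).

Lemma cell_ex x : exists i, cell xs e i x.
Proof.
have [n] := xsP x e0; elim/ltn_ind: n => n IH xn.
have [[j jn xj]|H] := pselect (exists2 j, (j < n)%N & mdist x (xs j) < e).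
  exact: IH xj.
by exists n; split => // j jn; rewrite leNgt; apply/negP => xj; apply: H; exists j.
Qed.

Lemma cell_uniq i j x : cell xs e i x -> cell xs e j x -> i = j.
Proof.
move=> [xi Hi] [xj Hj]; apply/eqP; rewrite eqn_leq; apply/andP; split; rewrite leqNgt;
  apply/negP => ij.
- by have := lt_le_trans xj (Hi _ ij); rewrite ltxx.
- by have := lt_le_trans xi (Hj _ ij); rewrite ltxx.
Qed.

Lemma measurable_cell i : measurable (cell xs e i : set (borel X)).
Proof.
rewrite (_ : cell xs e i = [set y | mdist y (xs i) < e] `&`
    \bigcap_(j in [set j | (j < i)%N]) ~` [set y | mdist y (xs j) < e]); last first.
  apply/seteqP; split => x [xi H]; split => // j /= ji.
    by apply/negP; rewrite -leNgt H.
  by have := H j ji; rewrite /= => /negP; rewrite -leNgt.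
have m j : measurable ([set y | mdist y (xs j) < e] : set (borel X)).
  by apply: measurable_open; exact: open_mdist_lt.
apply: measurableI => //; case: i => [|i].
  rewrite (_ : bigcap _ _ = setT); first exact: measurableT.
  by apply/seteqP; split => // x _ j.
by apply: bigcap_measurable => [|j _]; [exists 0%N|exact: measurableC].
Qed.

Lemma cell_trivIset : trivIset setT (cell xs e).
Proof. by move=> i j _ _ [x [xi xj]]; exact: cell_uniq xi xj. Qed.

Lemma cell_cover : \bigcup_i cell xs e i = setT.
Proof. by apply/seteqP; split => // x _; have [i] := cell_ex x; exists i. Qed.

Lemma cell_diam i x y : cell xs e i x -> cell xs e i y -> mdist x y < e + e.
Proof.
move=> [xi _] [yi _]; apply: le_lt_trans (metric_triangle _ (xs i) _) _.
by rewrite (metric_sym (xs i)) ltrD.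
Qed.

Lemma measure_cells d (S : measurableType d) (m : {measure set S -> \bar R})
    (f : S -> borel X) (F : set S) : measurable_fun setT f -> measurable F ->
  m F = (\sum_(0 <= i <oo) m (F `&` f @^-1` cell xs e i))%E.
Proof.
move=> mf mF.
have mc i : measurable (F `&` f @^-1` cell xs e i).
  apply: measurableI => //; rewrite -[X in measurable X]setTI; apply: mf => //.
  exact: measurable_cell.
rewrite -measure_semi_bigcup//.
- by rewrite -setI_bigcupr -preimage_bigcup cell_cover preimage_setT setIT.
- move=> i j _ _ [s [[_ si] [_ sj]]]; exact: cell_uniq si sj.
- exact: bigcupT_measurable.
Qed.

End cells.

(* The conditional law of the second coordinate of [sigma] given the cell of the
   first one replaces the disintegration of [sigma]; the price is the error
   [e + e], the diameter of a cell. *)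
Lemma glue d (S : measurableType d) (P : probability S R) (f : S -> borel X)
    (mf : measurable_fun setT f) (sigma : probability (borel X * borel X)%type R)
    (e : R) : 0 < e ->
  (forall B : set (borel X), measurable B -> P (f @^-1` B) = sigma (fst @^-1` B)) ->
  exists Q : probability (S * (borel X * borel X))%type R,
  [/\ (forall F, measurable F -> Q (fst @^-1` F) = P F),
      (forall C, measurable C -> Q (snd @^-1` C) = sigma C) &
      Q [set w | e + e <= mdist (f w.1 : X) w.2.1] = 0%E].
Proof.
move=> e0 fE; have [xs xsP] := dense_seq_exists.
pose A i := f @^-1` cell xs e i.
pose B i : set (borel X * borel X) := fst @^-1` cell xs e i.
have mA i : measurable (A i).
  by rewrite -[X in measurable X]setTI; apply: mf => //; exact: measurable_cell.
have mB i : measurable (B i).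
  rewrite -[X in measurable X]setTI; apply: measurable_fst => //.
  exact: measurable_cell.
have AB i : P (A i) = sigma (B i) by apply: fE; exact: measurable_cell.
have c0 i : 0 <= (fine (P (A i)))^-1 by rewrite invr_ge0 fine_ge0.
(* Given the cell [i], the two components are independent, each with its conditional law; the weight
   [P (A i)] cancels one of the two normalizations. For a null cell the inverse is 0, consistently
   with [P (A i) = sigma (B i)]. *)
pose m i := mscale (NngNum (c0 i)) (mrestr P (mA i) \x mrestr sigma (mB i))%E.
pose Q := mseries m 0.
have mE i F C : measurable F -> measurable C ->
    m i (F `*` C) = ((fine (P (A i)))^-1%:E * (P (F `&` A i) * sigma (C `&` B i)))%E.
  by move=> mF mC; rewrite /m /mscale /= product_measure1E.
have PAfin i : P (A i) \is a fin_num by exact: fin_num_measure.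
have QF F : measurable F -> Q (fst @^-1` F) = P F.
  move=> mF; rewrite (measure_cells xsP e0 P mf mF) /Q /mseries.
  apply: eq_eseriesr => i _.
  have -> : fst @^-1` F = F `*` [set: borel X * borel X].
    by apply/seteqP; split => [w|w []].
  apply: (eq_trans (mE i F setT mF measurableT)); rewrite setTI -AB.
  have [p0|p0] := eqVneq (P (A i)) 0%E.
    rewrite p0 mule0 mule0; apply/esym/eqP; rewrite eq_le measure_ge0 andbT -p0.
    by apply: le_measure; rewrite ?inE//; exact: (measurableI _ _ mF (mA i)).
  rewrite muleC -muleA -{1}(fineK (PAfin i)) -EFinM divff ?mule1//.
  by rewrite fine_eq0.
have QC C : measurable C -> Q (snd @^-1` C) = sigma C.
  move=> mC; rewrite (measure_cells xsP e0 sigma measurable_fst mC) /Q /mseries.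
  apply: eq_eseriesr => i _.
  have -> : snd @^-1` C = [set: S] `*` C by apply/seteqP; split => [w|w []].
  apply: (eq_trans (mE i setT C measurableT mC)); rewrite setTI AB.
  have [p0|p0] := eqVneq (sigma (B i)) 0%E.
    rewrite p0 mul0e mule0; apply/esym/eqP; rewrite eq_le measure_ge0 andbT -p0.
    by apply: le_measure; rewrite ?inE//; exact: (measurableI _ _ mC (mB i)).
  rewrite muleA -{2}(@fineK _ (sigma (B i))) ?fin_num_measure// -EFinM mulVf ?mul1e//.
  by rewrite fine_eq0 ?fin_num_measure//.
have [Q' Q'E] : exists Q' : probability (S * (borel X * borel X))%type R,
    forall F, Q' F = Q F.
  apply: measure_probability.
  exact: (eq_trans (QF setT measurableT) (probability_setT P)).
exists Q'; split => [F mF|C mC|]; rewrite Q'E; [exact: QF|exact: QC|].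
have mN : measurable [set w : S * (borel X * borel X) | e + e <= mdist (f w.1 : X) w.2.1].
  rewrite (_ : [set _ | _] =
    (fun w : S * (borel X * borel X) => mdist (f w.1 : X) w.2.1) @^-1` `[e + e, +oo[); last first.
    by apply/seteqP; split => w /=; rewrite in_itv/= andbT.
  rewrite -[X in measurable X]setTI; apply: measurable_mdist => //.
    by apply: measurableT_comp => //; exact: measurable_fst.
  by apply: (measurableT_comp measurable_fst); exact: measurable_snd.
rewrite /Q /mseries eseries0// => i _ _.
apply/eqP; rewrite eq_le measure_ge0 andbT.
(* [m i] lives on the product of [A i] and [B i], where both points lie in the same cell. *)
apply: (@le_trans _ _ (m i ((~` A i `*` setT) `|` (setT `*` ~` B i)))).
  apply: le_measure; rewrite ?inE//.
    apply: measurableU; apply: measurableX => //; exact: measurableC.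
  move=> [s [x y]] /= H; have [si|] := pselect (A i s); last by left.
  right; split => // xi; move: H; rewrite leNgt.
  by rewrite (cell_diam si xi).
apply: (@le_trans _ _ (m i (~` A i `*` setT) + m i (setT `*` ~` B i))%E).
  by apply: measureU2; apply: measurableX => //; exact: measurableC.
by rewrite !mE//; [rewrite !setICl !measure0 mul0e !mule0 adde0|exact: measurableC|exact: measurableC].
Qed.

(** One step of the Markov chain. The probability space is enlarged and [p] forgets the new
    coordinate, so earlier variables survive as compositions with [p]. *)
Lemma extend d (S : measurableType d) (P : probability S R) (f : S -> borel X)
    (mf : measurable_fun setT f) (m1 m2 : probability (borel X) R) (c : R) :
  (forall B : set (borel X), measurable B -> P (f @^-1` B) = m1 B) ->
  (W1 m1 m2 < c%:E)%E ->
  exists d' (S' : measurableType d') (P' : probability S' R)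
    (p : S' -> S) (z : S' -> borel X),
  [/\ measurable_fun setT p, measurable_fun setT z,
      (forall F, measurable F -> P' (p @^-1` F) = P F),
      (forall B : set (borel X), measurable B -> P' (z @^-1` B) = m2 B) &
      (\int[P']_w emdist (f (p w) : X) (z w) <= c%:E)%E].
Proof.
move=> fE /ereal_inf_lt[_ [sigma cs <-] sc].
have mm : measurable_fun setT (fun z : borel X * borel X => emdist (z.1 : X) z.2).
  by apply: measurable_emdist; [exact: measurable_fst|exact: measurable_snd].
have i0 : (0 <= \int[sigma]_z emdist (z.1 : X) z.2)%E.
  by apply: integral_ge0 => z _; rewrite lee_fin mdist_ge0.
have ifin : (\int[sigma]_z emdist (z.1 : X) z.2)%E \is a fin_num.
  by rewrite ge0_fin_numE// (lt_trans sc)// ltry.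
(* The strict inequality leaves a slack between the cost of [sigma] and [c]; with cells of radius
   half the slack, the gluing error is at most the slack. *)
have e0 : 0 < (c - fine (\int[sigma]_z emdist (z.1 : X) z.2)%E) / 2.
  by rewrite divr_gt0// subr_gt0 -lte_fin fineK.
have fs B : measurable B -> P (f @^-1` B) = sigma (fst @^-1` B).
  by move=> mB; rewrite fE//; have [] := cs _ mB.
have [Q [QF QC QN]] := glue mf e0 fs.
exists _, (S * (borel X * borel X))%type, Q, fst, (fun w => w.2.2).
have m2' : measurable_fun setT (fun w : S * (borel X * borel X) => w.2.2).
  by apply: (measurableT_comp measurable_snd); exact: measurable_snd.
have m1' : measurable_fun setT (fun w : S * (borel X * borel X) => w.2.1).
  by apply: (measurableT_comp measurable_fst); exact: measurable_snd.
have mf' : measurable_fun setT (fun w : S * (borel X * borel X) => f w.1).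
  by apply: (measurableT_comp mf); exact: measurable_fst.
split; [exact: measurable_fst|exact: m2'|exact: QF| |].
  move=> B mB; have [_ <-] := cs _ mB; rewrite -[LHS]/(Q (snd @^-1` (snd @^-1` B))) QC//.
  by rewrite -[X in measurable X]setTI; exact: measurable_snd.
apply: (@le_trans _ _ (\int[Q]_w (emdist (f w.1 : X) w.2.1 + emdist (w.2.1 : X) w.2.2))%E).
  apply: ge0_le_integral => //.
  - by move=> w _; rewrite lee_fin mdist_ge0.
  - exact: measurable_emdist.
  - by apply: emeasurable_funD; exact: measurable_emdist.
  - by move=> w _; rewrite -EFinD lee_fin metric_triangle.
rewrite ge0_integralD//.
- have -> : (\int[Q]_w emdist (w.2.1 : X) w.2.2 = \int[sigma]_z emdist (z.1 : X) z.2)%E.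
    have [Q2 [Q2E Q2I]] := law_exists Q (measurable_snd : measurable_fun setT (snd : S * (borel X * borel X) -> _)).
    transitivity (\int[Q2]_z emdist (z.1 : X) z.2)%E.
      by rewrite Q2I// => z; rewrite lee_fin mdist_ge0.
    by apply: eq_measure_integral => C mC _; exact: (etrans (Q2E C) (QC C mC)).
  rewrite -(fineK ifin); apply: (@le_trans _ _ ((c - fine (\int[sigma]_z emdist (z.1 : X) z.2)%E)%:E +
    (fine (\int[sigma]_z emdist (z.1 : X) z.2))%:E)%E); last first.
    by rewrite -EFinD subrK.
  apply: leeD => //; set k := c - _.
  apply: (@le_trans _ _ (\int[Q]_w (cst k%:E w))%E); last first.
    exact: integral_cst_le.
  apply: ae_ge0_le_integral => //.
  + by move=> w _; rewrite lee_fin mdist_ge0.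
  + exact: measurable_emdist.
  + by move=> w _; rewrite lee_fin; have := e0; rewrite -/k; lra.
  exists [set w | k / 2 + k / 2 <= mdist (f w.1 : X) w.2.1]; split => //.
    rewrite (_ : [set _ | _] =
      (fun w : S * (borel X * borel X) => mdist (f w.1 : X) w.2.1) @^-1` `[k / 2 + k / 2, +oo[); last first.
      by apply/seteqP; split => w /=; rewrite in_itv/= andbT.
    by rewrite -[X in measurable X]setTI; apply: measurable_mdist.
  move=> w /= H; rewrite leNgt; apply/negP => H2; apply: H => _.
  rewrite lee_fin; lra.
- by move=> w _; rewrite lee_fin mdist_ge0.
- exact: measurable_emdist.
- by move=> w _; rewrite lee_fin mdist_ge0.
- exact: measurable_emdist.
Qed.

Lemma W1_le_law d (S : measurableType d) (P : probability S R) (f g : S -> borel X)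
    (m1 m2 : probability (borel X) R) :
  measurable_fun setT f -> measurable_fun setT g ->
  (forall B : set (borel X), measurable B -> P (f @^-1` B) = m1 B) ->
  (forall B : set (borel X), measurable B -> P (g @^-1` B) = m2 B) ->
  (W1 m1 m2 <= \int[P]_s emdist (f s : X) (g s))%E.
Proof.
move=> mf mg fE gE.
have mfg : measurable_fun setT (fun s => (f s, g s)) by exact: measurable_fun_pair.
have [Q [QE QI]] := law_exists P mfg.
apply: ereal_inf_lbound; exists Q.
  by move=> B mB; rewrite /pushforward !QE -fE// -gE.
rewrite QI//.
  by apply: measurable_emdist; [exact: measurable_fst|exact: measurable_snd].
by move=> z; rewrite lee_fin mdist_ge0.
Qed.

Lemma W1_ge0 (m1 m2 : probability (borel X) R) : (0 <= W1 m1 m2)%E.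
Proof.
apply: le_ereal_inf_tmp => _ [s _ <-].
by apply: integral_ge0 => z _; rewrite lee_fin mdist_ge0.
Qed.

Lemma W1xx (m : probability (borel X) R) : W1 m m = 0%E.
Proof.
apply/eqP; rewrite eq_le W1_ge0 andbT.
have := @W1_le_law _ (borel X) m id id m m (@measurable_id _ _ _) (@measurable_id _ _ _).
move=> /(_ (fun _ _ => erefl) (fun _ _ => erefl)) /le_trans; apply.
rewrite (eq_integral (cst 0%E)) ?integral0// => x _.
by rewrite /emdist mdistxx.
Qed.

Lemma W1_sym (m1 m2 : probability (borel X) R) : W1 m1 m2 = W1 m2 m1.
Proof.
suff H (m m' : probability (borel X) R) : (W1 m m' <= W1 m' m)%E by apply/eqP; rewrite eq_le !H.
apply: le_ereal_inf_tmp => _ [s cs <-].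
have := @W1_le_law _ _ s snd fst m m' measurable_snd measurable_fst.
move=> /(_ (fun B mB => (cs B mB).2) (fun B mB => (cs B mB).1)) /le_trans; apply.
rewrite le_eqVlt; apply/orP; left; apply/eqP; apply: eq_integral => z _.
by rewrite /emdist metric_sym.
Qed.

(** A nearly optimal coupling of [m1] and [m2] is itself a space on which [snd] has law [m2], so
    [extend] appends a third variable of law [m3]; approximate gluing is enough because of the
    margins [e / 2]. *)
Lemma W1_tri (m1 m2 m3 : probability (borel X) R) :
  (W1 m1 m3 <= W1 m1 m2 + W1 m2 m3)%E.
Proof.
have [->|y1] := eqVneq (W1 m1 m2) +oo%E; first by rewrite addye ?leey// -ltNye (lt_le_trans _ (W1_ge0 _ _)).
have [->|y2] := eqVneq (W1 m2 m3) +oo%E; first by rewrite addey ?leey// -ltNye (lt_le_trans _ (W1_ge0 _ _)).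
have f1 : W1 m1 m2 \is a fin_num by rewrite ge0_fin_numE ?W1_ge0// ltey.
have f2 : W1 m2 m3 \is a fin_num by rewrite ge0_fin_numE ?W1_ge0// ltey.
apply/lee_addgt0Pr => e e0.
have e2 : 0 < e / 2 by rewrite divr_gt0.
have /ereal_inf_lt[_ [s cs <-] sc] : (W1 m1 m2 < (fine (W1 m1 m2) + e / 2)%:E)%E.
  by rewrite -{1}(fineK f1) lte_fin ltrDl.
have lt2 : (W1 m2 m3 < (fine (W1 m2 m3) + e / 2)%:E)%E.
  by rewrite -{1}(fineK f2) lte_fin ltrDl.
have [d' [S' [P' [p [z [mp mz pE zE Hc]]]]]] :=
  extend measurable_snd (fun B mB => (cs B mB).2) lt2.
have mp1 : measurable_fun setT (fun w => (p w).1) by exact: (measurableT_comp measurable_fst).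
have mp2 : measurable_fun setT (fun w => (p w).2) by exact: (measurableT_comp measurable_snd).
apply: (@le_trans _ _ (\int[P']_w emdist ((p w).1 : X) (z w))%E).
  apply: W1_le_law => // B mB.
  have [<- _] := cs B mB; rewrite /pushforward -pE//.
  by rewrite -[X in measurable X]setTI; exact: measurable_fst.
apply: (@le_trans _ _ (\int[P']_w (emdist ((p w).1 : X) (p w).2 + emdist ((p w).2 : X) (z w)))%E).
  apply: ge0_le_integral => //.
  - by move=> w _; rewrite lee_fin mdist_ge0.
  - exact: measurable_emdist.
  - by apply: emeasurable_funD; exact: measurable_emdist.
  - by move=> w _; rewrite -EFinD lee_fin metric_triangle.
rewrite ge0_integralD//.
- have -> : (\int[P']_w emdist ((p w).1 : X) (p w).2 = \int[s]_z emdist (z.1 : X) z.2)%E.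
    have [Q2 [Q2E Q2I]] := law_exists P' mp.
    transitivity (\int[Q2]_z emdist (z.1 : X) z.2)%E.
      rewrite Q2I//; last by move=> ?; rewrite lee_fin mdist_ge0.
      by apply: measurable_emdist; [exact: measurable_fst|exact: measurable_snd].
    by apply: eq_measure_integral => C mC _; exact: (etrans (Q2E C) (pE C mC)).
  apply: (@le_trans _ _ ((fine (W1 m1 m2) + e / 2)%:E + (fine (W1 m2 m3) + e / 2)%:E)%E).
    by apply: leeD => //; exact: ltW.
  rewrite -(fineK f1) -(fineK f2) -!EFinD lee_fin /=; lra.
- by move=> w _; rewrite lee_fin mdist_ge0.
- exact: measurable_emdist.
- by move=> w _; rewrite lee_fin mdist_ge0.
- exact: measurable_emdist.
Qed.

Lemma ext_dist_W1 : ext_dist (@W1 R X).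
Proof. by split; [exact: W1_ge0|exact: W1xx|exact: W1_sym|exact: W1_tri]. Qed.

End metric_measure.

Lemma ext_dist_emdist (R : realType) (X : completeMetricType R) :
  ext_dist (@emdist R X).
Proof.
split => *; rewrite /emdist ?lee_fin ?mdist_ge0 ?mdistxx//.
- by rewrite metric_sym.
- exact: metric_triangle.
Qed.

(** * Limits of laws of bit sequences *)

(* The most recent bit comes first: words grow by cons. *)
Fixpoint rword (b : nat -> bool) (n : nat) : seq bool :=
  if n is n'.+1 then b n' :: rword b n' else [::].

Lemma size_rword b n : size (rword b n) = n.
Proof. by elim: n => //= n ->. Qed.

Lemma nth_rev_rword b n i : (i < n)%N -> nth false (rev (rword b n)) i = b i.
Proof.
elim: n => // n IH; rewrite ltnS /= rev_cons nth_rcons size_rev size_rword.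
by rewrite leq_eqVlt => /orP[/eqP ->|ilen]; rewrite ?ltnn ?eqxx// ilen IH.
Qed.

Section bit_sets.
Context d (S : measurableType d) (B : nat -> set S).
Hypothesis mB : forall n, measurable (B n).

Definition bitf (s : S) : nat -> bool := fun n => `[< B n s >].

Definition wset (v : seq bool) : set S := [set s | rword (bitf s) (size v) = v].

(** The cylinder of [v] with a condition on the word [j] bits longer. Splitting on the next bit
    writes any event on finitely many bits as a finite disjoint union of cylinders. *)
Definition eset (v : seq bool) (j : nat) (E : seq bool -> bool) : set S :=
  [set s | wset v s /\ E (rword (bitf s) (size v + j))].

Lemma wset_cons b v : wset (b :: v) = wset v `&` (if b then B (size v) else ~` B (size v)).
Proof.
apply/seteqP; split => s; rewrite /wset /=.
  move=> [bE ->]; split => //; move: bE; rewrite /bitf.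
  by case: b => [/asboolP//|/asboolP].
move=> [-> Bs]; congr cons; move: Bs; rewrite /bitf.
by case: b => H; [exact/asboolT|exact/asboolF].
Qed.

Lemma measurable_wset v : measurable (wset v).
Proof.
elim: v => [|b v IH]; first by rewrite (_ : wset _ = setT)//; apply/seteqP; split.
by rewrite wset_cons; apply: measurableI => //; case: b => //; exact: measurableC.
Qed.

Lemma eset0 v E : eset v 0 E = if E v then wset v else set0.
Proof.
apply/seteqP; split => s; rewrite /eset /= addn0.
  by move=> [sv]; rewrite sv => ->.
by case: ifP => // Ev sv; rewrite sv.
Qed.

Lemma esetS v j E : eset v j.+1 E = eset (true :: v) j E `|` eset (false :: v) j E.
Proof.
apply/seteqP; split => s; rewrite /eset !wset_cons /= addnS.
  by move=> [sv Es]; have [Bs|nBs] := pselect (B (size v) s); [left|right].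
by move=> [[[sv _] Es]|[[sv _] Es]].
Qed.

Lemma eset_disj v j E : eset (true :: v) j E `&` eset (false :: v) j E = set0.
Proof.
apply/seteqP; split => s //; rewrite /eset !wset_cons /=.
by move=> [[[_ Bs] _] [[_ /(_ Bs)]]].
Qed.

Lemma measurable_eset v j E : measurable (eset v j E).
Proof.
elim: j v => [|j IH] v; last by rewrite esetS; exact: measurableU.
by rewrite eset0; case: ifP => _ //; exact: measurable_wset.
Qed.

Definition fin_dep (Phi : (nat -> bool) -> bool) : Prop :=
  exists N, forall b b', (forall i, (i < N)%N -> b i = b' i) -> Phi b = Phi b'.

Lemma fin_dep_eset (Phi : (nat -> bool) -> bool) N :
  (forall b b', (forall i, (i < N)%N -> b i = b' i) -> Phi b = Phi b') ->
  [set s | Phi (bitf s)] = eset [::] N (fun v => Phi (nth false (rev v))).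
Proof.
move=> H; apply/seteqP; split => s; rewrite /eset /= add0n.
  move=> Ps; split => //; rewrite (H _ (bitf s))// => i iN.
  exact: nth_rev_rword.
move=> [_]; rewrite (H _ (bitf s))// => i iN.
exact: nth_rev_rword.
Qed.

End bit_sets.

Lemma ultra_cvg01 (R : realType) (U : set_system nat) (UU : UltraFilter U)
    (u : nat -> R) : (forall n, 0 <= u n <= 1) ->
  exists2 a, u @ U --> a & 0 <= a <= 1.
Proof.
move=> u01; have PU : ProperFilter U by exact: ultra_proper.
have [a [a01 ca]] : exists a, (`[(0 : R), 1] `&` cluster (u @ U)) a.
  apply: (@segment_compact R 0 1 (u @ U)).
  have H : U (u @^-1` `[0, 1]%classic) by apply: filterE => n /=; rewrite in_itv/=; exact: u01.
  exact: H.
exists a; last by move: a01; rewrite /= in_itv.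
move=> A nA; have [//|UA] := @in_ultra_setVsetC _ U (u @^-1` A) UU.
by have [x []] := ca (~` A) A UA nA.
Qed.

Section realization.
Context (R : realType) (q : seq bool -> R).
Hypothesis q1 : q [::] = 1.
Hypothesis q_ge0 : forall v, 0 <= q v.
Hypothesis qD : forall v, q v = q (true :: v) + q (false :: v).

(** The interval of a word is cut into that of its [false] child on the left and that of its [true]
    child on the right. *)
Fixpoint lft (v : seq bool) : R :=
  if v is b :: v' then lft v' + (if b then q (false :: v') else 0) else 0.

(* The words indexing the nested intervals [lft v, lft v + q v) that contain x:
   as these have length q v, a uniform x yields the word v with probability q v. *)
Fixpoint expansion (n : nat) (x : R) : seq bool :=
  if n is n'.+1 then
    let v := expansion n' x in (lft v + q (false :: v) <= x) :: v
  else [::].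

Definition digit (n : nat) : set R :=
  [set x | lft (expansion n x) + q (false :: expansion n x) <= x].

Lemma expansionE n x : expansion n x = rword (bitf (digit : nat -> set (measurableTypeR R)) x) n.
Proof. by elim: n => //= n <-; congr cons; rewrite /bitf /digit /= asboolb. Qed.

(** The last digit is a threshold test on [x] that depends on the preceding word. Letting [F] depend
    on the word allows this test to be absorbed into the set [G] of the induction step. *)
Lemma measurable_expansion n (F : seq bool -> set R) :
  (forall v, measurable (F v : set (measurableTypeR R))) ->
  measurable ([set x | F (expansion n x) x] : set (measurableTypeR R)).
Proof.
elim: n F => [|n IH] F mF /=; first exact: mF.
pose th v := lft v + q (false :: v).
pose G v := (F (true :: v) `&` `[th v, +oo[%classic) `|` (F (false :: v) `&` `]-oo, th v[%classic).
rewrite (_ : [set x | _] = [set x | G (expansion n x) x]).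
  by apply: IH => v; apply: measurableU; apply: measurableI.
apply/seteqP; split => x; rewrite /G /th /=; set v := expansion n x.
  have [vx|vx] := leP (lft v + q (false :: v)) x => Fx; [left|right];
  by rewrite in_itv/= ?andbT.
by rewrite !in_itv/= andbT => -[[Fx vx]|[Fx vx]]; rewrite ?vx// leNgt vx.
Qed.

Lemma measurable_digit n : measurable (digit n : set (measurableTypeR R)).
Proof.
rewrite (_ : digit n = [set x | (fun v => `[lft v + q (false :: v), +oo[%classic : set R) (expansion n x) x]).
  have := @measurable_expansion n (fun v => `[lft v + q (false :: v), +oo[%classic).
  by apply => v; exact: measurable_itv.
by apply/seteqP; split => x; rewrite /digit /= in_itv/= andbT.
Qed.

Lemma expansion_itv v : [/\ 0 <= lft v, lft v + q v <= 1 &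
  forall x, 0 <= x < 1 -> (expansion (size v) x = v <-> lft v <= x < lft v + q v)].
Proof.
elim: v => [|b v [l0 l1 IH]] /=; first by rewrite q1 add0r.
have := qD v; have := q_ge0 (true :: v); have := q_ge0 (false :: v) => qf qt qv.
split; [by rewrite addr_ge0//; case: b|by case: b; lra|].
move=> x x01; have [IH1 IH2] := IH x x01; case: b.
  split.
    by move=> [] /[swap] ev; rewrite ev => lx; have := IH1 ev; lra.
  move=> xl; have -> : expansion (size v) x = v by apply: IH2; lra.
  by congr cons; lra.
split.
  move=> [] /[swap] ev; rewrite ev => /negbT; rewrite -ltNge => lx.
  by have := IH1 ev; lra.
move=> xl; have -> : expansion (size v) x = v by apply: IH2; lra.
by congr cons; apply/negbTE; rewrite -ltNge; lra.
Qed.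

Lemma bits_realization : exists Q : probability (measurableTypeR R) R,
  forall v, Q (wset (digit : nat -> set (measurableTypeR R)) v) = (q v)%:E.
Proof.
have H v : mrestr lebesgue_measure (measurable_itv `[(0 : R), 1[)
    (wset (digit : nat -> set (measurableTypeR R)) v) = (q v)%:E.
  rewrite /mrestr; have [l0 l1 E] := expansion_itv v.
  rewrite (_ : _ `&` _ = `[lft v, lft v + q v[%classic).
    rewrite lebesgue_measure_itv /= lte_fin ltrDl.
    case: ltP (q_ge0 v) => [_ _|q0 q0'].
      by rewrite -EFinB addrC addKr.
    by congr (_%:E); apply/eqP; rewrite eq_le q0 q0'.
  apply/seteqP; split => x /=; rewrite /wset /= -expansionE !in_itv/=.
    by move=> [ex x01]; apply/(E x x01).
  move=> xl; have x01 : 0 <= x < 1 by lra.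
  by split => //; apply/(E x x01).
pose m := mrestr lebesgue_measure (measurable_itv `[(0 : R), 1[).
have [Q QE] : exists Q : probability (measurableTypeR R) R, forall A, Q A = m A.
  apply: measure_probability; rewrite /= /m /mrestr setTI lebesgue_measure_itv /=.
  by rewrite lte_fin ltr01 oppr0 adde0.
by exists Q => v; exact: (eq_trans (QE _) (H v)).
Qed.

End realization.

Section fin_dep.
Implicit Types Phi : (nat -> bool) -> bool.

Lemma fin_dep_bit n : fin_dep (fun b => b n).
Proof. by exists n.+1 => b b'; apply. Qed.

Lemma fin_dep_not Phi : fin_dep Phi -> fin_dep (fun b => ~~ Phi b).
Proof. by move=> [N HN]; exists N => b b' /HN ->. Qed.

Lemma fin_dep_and Phi Phi' : fin_dep Phi -> fin_dep Phi' ->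
  fin_dep (fun b => Phi b && Phi' b).
Proof.
move=> [N HN] [N' HN']; exists (maxn N N') => b b' H.
by congr andb; [apply: HN => i iN|apply: HN' => i iN]; apply: H; rewrite leq_max iN ?orbT.
Qed.

Lemma fin_dep_all (F : nat -> (nat -> bool) -> bool) (s : seq nat) :
  (forall i, fin_dep (F i)) -> fin_dep (fun b => all (F^~ b) s).
Proof.
move=> HF; elim: s => [|i s IH] /=; first by exists 0%N.
exact: fin_dep_and.
Qed.

End fin_dep.

Section limits.
Context (R : realType) (dk : nat -> measure_display).
Context (S : forall k, measurableType (dk k)) (P : forall k, probability (S k) R).

(** All word probabilities lie in [[0, 1]], hence converge along a single ultrafilter, with no
    diagonal extraction; the additivity [qD] passes to the limit and [bits_realization] provides the
    space. Events on finitely many bits follow as finite sums over cylinders. *)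
Lemma bits_limit (B : forall k, nat -> set (S k)) :
  (forall k n, measurable (B k n)) ->
  exists U : set_system nat, [/\ UltraFilter U, \oo `<=` U &
  exists (Q : probability (measurableTypeR R) R) (B' : nat -> set (measurableTypeR R)),
  (forall n, measurable (B' n)) /\
  forall Phi, fin_dep Phi ->
    fine (P k [set s | Phi (bitf (B k) s)]) @[k --> U] -->
    fine (Q [set s | Phi (bitf B' s)])].
Proof.
move=> mB; have [U [UU sU]] := @ultraFilterLemma nat \oo _.
exists U; split => //; have PU : ProperFilter U by exact: ultra_proper.
pose u v k := fine (P k (wset (B k) v)).
have u01 v n : 0 <= u v n <= 1.
  rewrite fine_ge0//= -lee_fin fineK ?probability_le1//.
    exact: measurable_wset.
  by apply: fin_num_measure; exact: measurable_wset.
have /choice[q qP] : forall v, exists a, u v @ U --> a /\ 0 <= a <= 1.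
  by move=> v; have [a] := ultra_cvg01 UU (u01 v); exists a.
have lim_uniq (v : nat -> R) (a b : R) : v @ U --> a -> v @ U --> b -> a = b.
  by move=> va vb; transitivity (lim (v @ U)); [apply/esym|]; exact: cvg_lim.
have q1 : q [::] = 1.
  apply: (lim_uniq _ _ _ (qP [::]).1); rewrite (_ : u [::] = cst 1); first exact: cvg_cst.
  apply/funext => k; rewrite /u (_ : wset _ _ = setT) ?probability_setT//.
  by apply/seteqP; split.
have q0 v : 0 <= q v by have [_ /andP[]] := qP v.
have qD v : q v = q (true :: v) + q (false :: v).
  apply: (lim_uniq _ _ _ (qP v).1).
  rewrite (_ : u v = (fun k => u (true :: v) k + u (false :: v) k)).
    exact: cvgD (qP _).1 (qP _).1.
  apply/funext => k; rewrite /u !wset_cons.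
  rewrite -fineD; last 2 first.
  - by apply: fin_num_measure; apply: measurableI => //; exact: measurable_wset.
  - by apply: fin_num_measure; apply: measurableI; [exact: measurable_wset|exact: measurableC].
  rewrite -measureU; last 3 first.
  - by apply: measurableI => //; exact: measurable_wset.
  - by apply: measurableI; [exact: measurable_wset|exact: measurableC].
  - by rewrite setIACA setICr setI0.
  by rewrite -setIUr setUCr setIT.
have [Q QE] := bits_realization q1 q0 qD.
exists Q, (digit q : nat -> set (measurableTypeR R)); split; first exact: measurable_digit.
set B' := (X in bitf X).
have mB' : forall n, measurable (B' n) by exact: measurable_digit.
have wcvg v : fine (P k (wset (B k) v)) @[k --> U] --> fine (Q (wset B' v)).
  by rewrite QE; exact: (qP v).1.
have ecvg j v E : fine (P k (eset (B k) v j E)) @[k --> U] --> fine (Q (eset B' v j E)).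
  elim: j v => [|j IH] v.
    have E0 d' (S' : measurableType d') (P' : probability S' R) (C : nat -> set S') :
        fine (P' (eset C v 0 E)) = if E v then fine (P' (wset C v)) else 0.
      by rewrite eset0; case: ifP => // _; rewrite measure0.
    rewrite E0; under eq_fun do rewrite E0.
    by case: (E v); [exact: wcvg|exact: cvg_cst].
  have D d' (S' : measurableType d') (P' : probability S' R) (C : nat -> set S') :
      (forall n, measurable (C n)) ->
      fine (P' (eset C v j.+1 E)) =
      fine (P' (eset C (true :: v) j E)) + fine (P' (eset C (false :: v) j E)).
    move=> mC; rewrite esetS measureU ?fineD//; try exact: fin_num_measure (measurable_eset mC _ _ _).
    - exact: measurable_eset.
    - exact: measurable_eset.
    - exact: eset_disj.
  rewrite D//; under eq_fun do rewrite D//.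
  by apply: cvgD; exact: IH.
move=> Phi [N HN].
by rewrite (fin_dep_eset _ HN); under eq_fun do rewrite (fin_dep_eset _ HN); exact: ecvg.
Qed.

(** The bits record, for all pairs of a partition [a] and a cell [i], whether the cell is visited.
    The limit cells of a partition are disjoint but not claimed to cover; covering up to a null set
    comes later from the marginals. *)
Lemma partitions_limit (C : forall k, nat -> nat -> set (S k)) :
  (forall k a i, measurable (C k a i)) ->
  (forall k a, trivIset setT (C k a)) ->
  exists U : set_system nat, [/\ UltraFilter U, \oo `<=` U &
  exists (Q : probability (measurableTypeR R) R) (A : nat -> nat -> set (measurableTypeR R)),
  [/\ (forall a i, measurable (A a i)), (forall a, trivIset setT (A a)) &
  forall a i a' i', fine (P k (C k a i `&` C k a' i')) @[k --> U] -->
    fine (Q (A a i `&` A a' i'))]].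
Proof.
move=> mC tC.
pose B k (n : nat) := if unpickle n is Some ai then C k ai.1 ai.2 else set0.
have mB k n : measurable (B k n) by rewrite /B; case: unpickle.
have BE k a i : B k (pickle (a, i)) = C k a i by rewrite /B pickleK.
have [U [UU sU [Q [B' [mB' HB']]]]] := bits_limit mB.
exists U; split => //.
(* The sets [B'] of one partition might overlap, so only the first index whose bit is set is kept.
   On the spaces [S k] this changes nothing, since there the cells are disjoint. *)
pose Phi (a i : nat) (b : nat -> bool) := b (pickle (a, i)) &&
  all (fun i' => ~~ b (pickle (a, i'))) (iota 0 i).
have fPhi a i : fin_dep (Phi a i).
  apply: fin_dep_and; first exact: fin_dep_bit.
  by apply: fin_dep_all => i'; apply: fin_dep_not; exact: fin_dep_bit.
pose A a i := [set x | Phi a i (bitf B' x)].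
exists Q, A; split.
- by move=> a i; have [N HN] := fPhi a i; rewrite /A (fin_dep_eset _ HN); exact: measurable_eset.
- have H a i i' x : Phi a i (bitf B' x) -> Phi a i' (bitf B' x) -> ~ (i < i')%N.
    move=> /andP[bi _] /andP[_ /allP H] ii'.
    by have := H i; rewrite mem_iota ii' => /(_ isT); rewrite bi.
  move=> a i i' _ _ [x [xi xi']]; apply/eqP; rewrite eqn_leq; apply/andP.
  by split; rewrite leqNgt; apply/negP; exact: H xi' || exact: H xi.
move=> a i a' i'.
have := HB' _ (fin_dep_and (fPhi a i) (fPhi a' i')).
have CE k a0 i0 s : Phi a0 i0 (bitf (B k) s) <-> C k a0 i0 s.
  rewrite /Phi /bitf BE; split => [/andP[/asboolP]//|Cs].
  rewrite asboolT//=; apply/allP => i1; rewrite mem_iota add0n => /andP[_ i10].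
  apply/negP => /asboolP; rewrite BE => Cs1.
  have := tC k a0 i1 i0 I I; move=> /(_ (ex_intro _ s (conj Cs1 Cs))) ii.
  by rewrite ii ltnn in i10.
have -> : [set s | Phi a i (bitf B' s) && Phi a' i' (bitf B' s)] = A a i `&` A a' i'.
  by apply/seteqP; split => s /=; [move=> /andP[]|move=> [? ?]; apply/andP].
rewrite (_ : (fun k => fine (P k [set s | _])) = fun k => fine (P k (C k a i `&` C k a' i')))//.
apply/funext => k; congr (fine (P k _)).
apply/seteqP; split => s /=; first by move=> /andP[/CE ? /CE].
by move=> [/CE ? /CE ?]; apply/andP.
Qed.

End limits.

(** * Processes with finitely and countably many times *)

Lemma integral_law (R : realType) d d' (S : measurableType d) (S' : measurableType d')
    (P : probability S R) (P' : probability S' R) (p : S' -> S) (h : S -> \bar R) :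
  measurable_fun setT p -> (forall F, measurable F -> P' (p @^-1` F) = P F) ->
  measurable_fun setT h -> (forall x, 0 <= h x)%E ->
  (\int[P']_w h (p w) = \int[P]_x h x)%E.
Proof.
move=> mp pE mh h0; have [Q [QE QI]] := law_exists P' mp.
rewrite -QI//; apply: eq_measure_integral => C mC _.
exact: (etrans (QE C) (pE C mC)).
Qed.

Lemma measurable_if_set (d1 d2 : measure_display) (S1 : measurableType d1)
    (S2 : measurableType d2) (G : set S1) (f g : S1 -> S2) :
  measurable G -> measurable_fun setT f -> measurable_fun setT g ->
  measurable_fun setT (fun x => if x \in G then f x else g x).
Proof.
move=> mG mf mg _ B mB; rewrite setTI.
rewrite (_ : _ @^-1` B = (G `&` f @^-1` B) `|` (~` G `&` g @^-1` B)); last first.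
  apply/seteqP; split => x /=.
    by case: ifPn => [/set_mem Gx fB|/negP Gx gB]; [left|right; split=> // /mem_set].
  by case: ifPn => [/set_mem Gx [[]|[]]//|/negP Gx [[/mem_set]|[]]].
apply: measurableU; apply: measurableI => //; last 2 first.
- exact: measurableC.
- by rewrite -[X in measurable X]setTI; exact: mg.
by rewrite -[X in measurable X]setTI; exact: mf.
Qed.

Lemma sorted_times (R : realType) (T : R) (l : seq (time T)) :
  exists2 l', sorted (@tlt R T) l' & l' =i l.
Proof.
elim: l => [|s l [l' sl' ll']]; first by exists [::].
exists ([seq t <- l' | tlt t s] ++ s :: [seq t <- l' | tlt s t]).
  exact: sorted_pivot.
move=> t; rewrite mem_cat !inE !mem_filter ll'.
have [->|/tlt_total/orP[->|->]] := eqVneq t s; rewrite ?orbT//.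
- by case: (t \in l); rewrite /= ?andbF.
- by case: (t \in l); rewrite ?andbF ?orbT.
Qed.

Section chains.
Context (R : realType) (X : completeMetricType R) (hX : separable_space X) (T : R).
Context (mu : time T -> probability (borel X) R) (V : time T -> R).
Hypothesis HV : forall s t : time T, val s < val t -> (W1 (mu s) (mu t) < (V t - V s)%:E)%E.

(** The new time [u] is coupled to its predecessor [r] only. For earlier times the bound follows
    from the triangle inequality, since increments of [V] add up. *)
Lemma chain (l : seq (time T)) : sorted (@tlt R T) l ->
  exists d (S : measurableType d) (P : probability S R) (Y : time T -> S -> borel X),
  [/\ (forall t, measurable_fun setT (Y t)),
      (forall t, t \in l -> forall B : set (borel X), measurable B -> P (Y t @^-1` B) = mu t B) &
      (forall s t, s \in l -> t \in l -> val s < val t ->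
         (\int[P]_x emdist (Y s x : X) (Y t x) <= (V t - V s)%:E)%E)].
Proof.
elim/last_ind: l => [|l u IH] sl.
  by exists _, (borel X), (dirac point), (fun=> id); split.
case/lastP: l => [|l r] in IH sl *.
  exists _, (borel X), (mu u), (fun=> id); split => //.
  - by move=> t; rewrite inE => /eqP ->.
  - by move=> s t; rewrite !inE => /eqP -> /eqP ->; rewrite ltxx.
move: sl; rewrite (sorted_pairwise (@tlt_trans R T)) pairwise_rcons => /andP[/allP lu].
rewrite -(sorted_pairwise (@tlt_trans R T)) => sl.
have lr s : s \in rcons l r -> s = r \/ val s < val r.
  move: sl; rewrite (sorted_pairwise (@tlt_trans R T)) pairwise_rcons => /andP[/allP lr _].
  by rewrite mem_rcons inE => /orP[/eqP ->|/lr]; [left|right].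
have [d [S [P [Y [mY YE YI]]]]] := IH sl.
have rl : r \in rcons l r by rewrite mem_rcons mem_head.
have [d' [S' [P' [p [z [mp mz pE zE Hc]]]]]] := extend hX (mY r) (YE r rl) (HV (lu r rl)).
have ul : u \notin rcons l r by apply/negP => /lu; rewrite /tlt /= ltxx.
pose Y' t : S' -> borel X := if t == u then z else Y t \o p.
have mY' t : measurable_fun setT (Y' t).
  by rewrite /Y'; case: ifP => // _; exact: measurableT_comp.
have neq s : s \in rcons l r -> (s == u) = false.
  by move=> sl'; apply/negbTE; apply: contraNneq ul => <-.
have I1 s t : s \in rcons l r -> t \in rcons l r -> val s < val t ->
    (\int[P']_x emdist (Y (s) (p x) : X) (Y t (p x)) <= (V t - V s)%:E)%E.
  move=> sl' tl' st; rewrite (integral_law (h := fun x => emdist (Y s x : X) (Y t x)) mp pE)//.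
  - exact: YI.
  - exact: measurable_emdist.
  - by move=> x; rewrite lee_fin mdist_ge0.
exists d', S', P', Y'; split => //.
- move=> t; rewrite mem_rcons inE /Y'.
  case: eqP => [->|_] //= tl B mB; rewrite -(YE t tl B mB) -pE//.
  by rewrite -[X in measurable X]setTI; exact: mY.
move=> s t; rewrite mem_rcons inE => /orP[/eqP ->|sl'].
  rewrite mem_rcons inE => /orP[/eqP ->|/lu]; first by rewrite ltxx.
  by rewrite /tlt /= => /lt_trans h /h; rewrite ltxx.
rewrite mem_rcons inE => /orP[/eqP -> su|tl' st]; last first.
  by rewrite /Y' !neq//; exact: I1.
rewrite /Y' eqxx neq//=.
have [->//|sr] := lr s sl'.
have m1 : measurable_fun setT (Y s \o p) by exact: measurableT_comp.
have m2 : measurable_fun setT (Y r \o p) by exact: measurableT_comp.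
apply: (@le_trans _ _ (\int[P']_x (emdist (Y s (p x) : X) (Y r (p x)) + emdist (Y r (p x) : X) (z x)))%E).
  apply: ge0_le_integral => //.
  - by move=> w _; rewrite lee_fin mdist_ge0.
  - exact: (measurable_emdist hX m1 mz).
  - by apply: emeasurable_funD; [exact: (measurable_emdist hX m1 m2)|exact: (measurable_emdist hX m2 mz)].
  - by move=> w _; rewrite -EFinD lee_fin metric_triangle.
rewrite ge0_integralD//.
- have -> : (V u - V s)%:E = ((V r - V s)%:E + (V u - V r)%:E)%E by rewrite -EFinD; congr (_%:E); ring.
  by apply: leeD => //; exact: I1.
- by move=> w _; rewrite lee_fin mdist_ge0.
- exact: (measurable_emdist hX m1 m2).
- by move=> w _; rewrite lee_fin mdist_ge0.
- exact: (measurable_emdist hX m2 mz).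
Qed.

End chains.

(** * Recovering points from the cells of all meshes *)

Section limit_process.
Context (R : realType) (X : completeMetricType R) (hX : separable_space X).
Context (xs : nat -> X).
Hypothesis xsP : forall (x : X) (e : R), 0 < e -> exists n, mdist x (xs n) < e.

Let e (m : nat) : R := m.+1%:R^-1.

Let e_gt0 m : 0 < e m. Proof. by rewrite invr_gt0. Qed.

Let e_lt (r : R) : 0 < r -> \forall m \near \oo, e m < r.
Proof. by move=> r0; exact: (near_infty_natSinv_lt (PosNum r0)). Qed.

(** Completeness with an explicit rate: in the bound for [u m] and [u m'], the part [e m'] vanishes
    as [m'] grows and [e m] remains. *)
Lemma fast_cauchy_lim (u : nat -> X) :
  (forall m m', mdist (u m) (u m') < e m + e m') ->
  exists y, forall m, mdist (u m) y <= e m.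
Proof.
move=> Hu.
have cu : cauchy (u @ \oo).
  apply: cauchy_exP => r r0.
  have r20 : 0 < r / 2 by rewrite divr_gt0.
  have [N _ HN] := e_lt r20.
  exists (u N); exists N => // n Nn /=; rewrite ballEmdist /=.
  apply: (lt_trans (Hu N n)); rewrite (splitr r).
  by apply: ltrD; [exact: (HN N (leqnn N))|exact: HN].
have /cvg_ex[y uy] : cvg (u @ \oo) by exact: cauchy_cvg.
exists y => m; apply/ler_addgt0Pr => r r0.
have r20 : 0 < r / 2 by rewrite divr_gt0.
have [N _ HN] := e_lt r20.
have /= := uy _ (nbhsx_ballx y _ r20).
case=> N' _ HN'.
have H1 := HN' (maxn N N') (leq_maxr _ _); have H2 := HN (maxn N N') (leq_maxl _ _).
move: H1 H2; rewrite /= ballEmdist /= metric_sym => H1 H2.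
have := metric_triangle (u m) (u (maxn N N')) y; have := Hu m (maxn N N'); lra.
Qed.

Context d (S : measurableType d) (Q : probability S R).
(** [A j m i] stands for the event that the [j]-th point lies in cell [i] of mesh [m]. [HA2]
    reflects that genuine cells with centres so far apart have no common point. *)
Context (A : nat -> nat -> nat -> set S) (nu : nat -> probability (borel X) R).
Hypothesis mA : forall j m i, measurable (A j m i).
Hypothesis tA : forall j m, trivIset setT (A j m).
Hypothesis HA1 : forall j m i, Q (A j m i) = nu j (cell xs (e m) i).
Hypothesis HA2 : forall j m i m' i', e m + e m' <= mdist (xs i) (xs i') ->
  Q (A j m i `&` A j m' i') = 0%E.

Let cov j m := \bigcup_i A j m i.

Let mcov j m : measurable (cov j m). Proof. exact: bigcupT_measurable. Qed.

(** This is where no mass escapes: the limit cells have the masses that [nu j] gives to genuine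
    cells, and these cover [X]. *)
Let cov0 j m : Q (~` cov j m) = 0%E.
Proof.
rewrite probability_setC// /cov measure_semi_bigcup//; last exact: bigcupT_measurable.
rewrite (eq_eseriesr (g := fun i => nu j (cell xs (e m) i))); last by move=> i _; exact: HA1.
rewrite -measure_semi_bigcup//.
- rewrite [X in (_ - X)%E](_ : _ = 1%E) ?subee//.
  by rewrite (cell_cover xsP (e_gt0 m)); exact: probability_setT.
- by move=> i; exact: measurable_cell.
- exact: cell_trivIset.
- by apply: bigcupT_measurable => i; exact: measurable_cell.
Qed.

Let approx j m (x : S) : X := xs (xget 0%N [set i | A j m i x]).

Let approxE j m i x : A j m i x -> approx j m x = xs i.
Proof.
move=> Ax; rewrite /approx; case: xgetP => [i' _ Ax'|/(_ i Ax)//].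
by congr (xs _); apply: (tA (j := j) (m := m)) => //; exists x.
Qed.

Let measurable_approx j m : measurable_fun setT (approx j m : S -> borel X).
Proof.
move=> _ B mB; rewrite setTI.
rewrite (_ : _ @^-1` B = \bigcup_i (if xs i \in B then A j m i else set0) `|`
  (if xs 0%N \in B then ~` cov j m else set0)); last first.
  apply/seteqP; split => x /=.
    move=> Bx; have [[i _ Ai]|ncov] := pselect (cov j m x).
      by left; exists i => //; rewrite -(approxE Ai) mem_set.
    right; move: Bx; rewrite /approx; case: xgetP => [i _ Ai|_ /mem_set ->//].
    by exfalso; apply: ncov; exists i.
  move=> [[i _]|]; case: ifPn => // /set_mem Bx.
    by move=> /approxE ->.
  move=> ncov; rewrite /approx; case: xgetP => [i _ Ai|//].
  by exfalso; apply: ncov; exists i.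
apply: measurableU; last by case: ifP => // _; exact: measurableC.
by apply: bigcupT_measurable => i; case: ifP.
Qed.

(** Null by [HA2]. Off these events the centres seen at different meshes satisfy the hypothesis of
    [fast_cauchy_lim]. *)
Let bad j m m' := \bigcup_i \bigcup_i'
  (if e m + e m' <= mdist (xs i) (xs i') then A j m i `&` A j m' i' else set0).

Let mbad j m m' : measurable (bad j m m').
Proof.
apply: bigcupT_measurable => i; apply: bigcupT_measurable => i'.
by case: ifP => // _; exact: measurableI.
Qed.

Let bad0 j m m' : Q.-negligible (bad j m m').
Proof.
apply: negligible_bigcup => i; apply: negligible_bigcup => i'.
case: ifP => [H|_]; last exact: negligible_set0.
by apply/negligibleP; [exact: measurableI|exact: HA2].
Qed.

Let good := ~` (\bigcup_j \bigcup_m (~` cov j m `|` \bigcup_m' bad j m m')).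

Let mgood : measurable good.
Proof.
apply: measurableC; apply: bigcupT_measurable => j; apply: bigcupT_measurable => m.
by apply: measurableU; [exact: measurableC|exact: bigcupT_measurable].
Qed.

Let good0 : Q (~` good) = 0%E.
Proof.
apply: measure_negligible; first exact: measurableC.
rewrite /good setCK; apply: negligible_bigcup => j; apply: negligible_bigcup => m.
apply: negligibleU; last exact: negligible_bigcup.
by apply/negligibleP; [exact: measurableC|exact: cov0].
Qed.

Let good_cov j m x : good x -> exists i, A j m i x.
Proof.
move=> gx; apply: contrapT => nA; apply: gx; exists j => //; exists m => //.
by left => -[i _ Ai]; apply: nA; exists i.
Qed.

Let good_close j m m' x : good x -> mdist (approx j m x) (approx j m' x) < e m + e m'.
Proof.
move=> gx; have [i Ai] := good_cov j m gx; have [i' Ai'] := good_cov j m' gx.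
rewrite (approxE Ai) (approxE Ai') ltNge; apply/negP => H.
apply: gx; exists j => //; exists m => //; right; exists m' => //.
by exists i => //; exists i' => //; rewrite H.
Qed.

(** With the pairs of cells enumerated by [n], the sum of [wgt n] times the probability of
    [pair_event n] is the mean distance between the two centres. Its partial sums involve finitely
    many events, so they pass to the limit. *)
Definition wgt (n : nat) : R :=
  if @pickle_inv (nat * nat)%type n is Some p then mdist (xs p.1) (xs p.2) else 0.

Definition pair_event d' (S' : measurableType d') (B B' : nat -> set S') (n : nat) : set S' :=
  if @pickle_inv (nat * nat)%type n is Some p then B p.1 `&` B' p.2 else set0.

Lemma wgt_ge0 n : 0 <= wgt n.
Proof. by rewrite /wgt; case: pickle_inv => // p; exact: mdist_ge0. Qed.

Lemma limit_process_exists : exists g : nat -> S -> borel X,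
  [/\ (forall j, measurable_fun setT (g j)),
      (forall j (B : set (borel X)), measurable B -> Q (g j @^-1` B) = nu j B) &
      (forall j j' (c : R),
        (forall m N, \sum_(0 <= n < N) wgt n * fine (Q (pair_event (A j m) (A j' m) n)) <=
           c + (e m + e m)) ->
        (\int[Q]_x emdist (g j x : X) (g j' x) <= c%:E)%E)].
Proof.
have /choice[g Hg] : forall j, exists f : S -> X,
    forall x, (good x -> forall m, mdist (approx j m x) (f x) <= e m) /\
      (~ good x -> f x = point).
  move=> j.
  have /choice[f Hf] : forall x, exists y, (good x -> forall m, mdist (approx j m x) y <= e m) /\
      (~ good x -> y = point).
    move=> x; have [gx|ngx] := pselect (good x); last by exists point.
    have [y Hy] := @fast_cauchy_lim (fun m => approx j m x) (fun m m' => good_close j m m' gx).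
    by exists y.
  by exists f.
have cvg0 (u : nat -> R) : (forall n, 0 <= u n <= e n) -> u @ \oo --> (0 : R).
  move=> Hu; apply/cvgrPdist_le => r r0; apply: filterS (e_lt r0) => n en.
  have /andP[u0 ue] := Hu n.
  by rewrite sub0r normrN ger0_norm// (le_trans ue)// ltW.
have mg j : measurable_fun setT (g j : S -> borel X).
  apply: (@measurable_lim R X hX _ S (fun n x => if x \in good then approx j n x else point) (g j)).
    move=> n; apply: (measurable_if_set mgood) => //; exact: measurable_approx.
  move=> x; apply: cvg0 => n; rewrite mdist_ge0/=.
  have [H1 H2] := Hg j x; case: ifPn => [/set_mem gx|/negP ngx]; first exact: H1.
  by rewrite H2 ?mdistxx ?(ltW (e_gt0 _))// => /mem_set.
exists g; split => //.
  move=> j; apply: (law_limit (u := approx j) _ _ mgood good0) => //.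
    move=> x gx; apply: cvg0 => n; rewrite mdist_ge0/=.
    by have [H1 _] := Hg j x; exact: H1.
  (* As soon as [e m < r], a cell whose centre lies in [inner U r] is contained in [U], so these
     cells together have mass at most [nu j U]. *)
  move=> U r r' oU r0 r'0; apply: filterS (e_lt r0) => m mr.
  apply: (@le_trans _ _ (nu j U)); last by rewrite leeDl// lee_fin ltW.
  pose D i := if `[< inner U r (xs i) >] then A j m i else set0.
  have mD i : measurable (D i) by rewrite /D; case: ifP.
  have tD : trivIset setT D.
    move=> i i' _ _ [x []]; rewrite /D; case: ifP => // _ xi; case: ifP => // _ xi'.
    by apply: (tA (j := j) (m := m)) => //; exists x.
  have mpre : measurable (approx j m @^-1` inner U r).
    rewrite -[X in measurable X]setTI; apply: measurable_approx => //.
    by apply: measurable_open; exact: open_inner.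
  apply: (@le_trans _ _ (Q (\bigcup_i D i `|` ~` cov j m))).
    apply: le_measure; rewrite ?inE//.
      by apply: measurableU; [exact: bigcupT_measurable|exact: measurableC].
    move=> x /= xU; have [[i _ Ai]|ncov] := pselect (cov j m x); last by right.
    by left; exists i => //; rewrite /D asboolT// -(approxE Ai).
  apply: (@le_trans _ _ (Q (\bigcup_i D i) + Q (~` cov j m))%E).
    by apply: measureU2; [exact: bigcupT_measurable|exact: measurableC].
  rewrite cov0 adde0 measure_semi_bigcup//; last exact: bigcupT_measurable.
  have mU := measurable_open oU.
  rewrite (@measure_cells R X xs xsP (e m) (e_gt0 m) _ (borel X) (nu j) id U (@measurable_id _ _ _) mU).
  apply: lee_nneseries => i _ //.
  rewrite /D; case: asboolP => [[s rs Hs]|_]; last by rewrite measure0.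
  apply: (@le_trans _ _ (nu j (cell xs (e m) i))).
    by rewrite le_eqVlt; apply/orP; left; apply/eqP; exact: HA1.
  apply: le_measure; rewrite ?inE; first exact: measurable_cell.
    by apply: measurableI => //; exact: measurable_cell.
  move=> y [yi yj]; split; last by split.
  by apply: Hs; rewrite metric_sym (lt_trans yi)// (lt_trans mr).
move=> j j' c Hc; apply/lee_addgt0Pr => r r0.
(* Four errors [e m] occur: two from replacing the points by the centres of their cells, two from
   the hypothesis on the partial sums. *)
have r40 : 0 < r / 4 by rewrite divr_gt0.
have [m _ /(_ m (leqnn _)) /= mr] := e_lt r40.
pose D := pair_event (A j m) (A j' m).
have mD n : measurable (D n).
  by rewrite /D /pair_event; case: pickle_inv => // p; exact: measurableI.
pose f n x := ((wgt n)%:E * (\1_(D n) x)%:E)%E.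
have f0 n x : (0 <= f n x)%E by rewrite mule_ge0// lee_fin ?wgt_ge0.
have mf n : measurable_fun setT (f n).
  by apply: measurable_funeM; apply/measurable_EFinP.
have ptw x : good x -> (emdist (g j x) (g j' x) <= \sum_(0 <= n <oo) f n x + (e m + e m)%:E)%E.
  move=> gx; have [i Ai] := good_cov j m gx; have [i' Ai'] := good_cov j' m gx.
  apply: (@le_trans _ _ ((mdist (xs i) (xs i'))%:E + (e m + e m)%:E)%E).
    rewrite -EFinD lee_fin.
    have [H1 _] := Hg j x; have [H2 _] := Hg j' x.
    have := H1 gx m; have := H2 gx m; rewrite (approxE Ai) (approxE Ai').
    have := metric_triangle (g j x) (xs i) (g j' x).
    have := metric_triangle (xs i) (xs i') (g j' x).
    rewrite (metric_sym (g j x) (xs i)); lra.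
  apply: leeD => //.
  (* The term indexed by the pair of cells actually visited is already the distance between the
     centres. *)
  apply: le_trans (nneseries_lim_ge (pickle (i, i')).+1 _) => //.
  rewrite big_nat_recr//=; apply: (@le_trans _ _ (f (pickle (i, i')) x)).
    by rewrite /f /wgt /D /pair_event pickleK_inv /= indicE mem_set//= mule1.
  by rewrite leeDr// sume_ge0.
have ms : measurable_fun setT (fun x => \sum_(0 <= n <oo) f n x)%E.
  exact: ge0_emeasurable_sum.
have s0 x : (0 <= \sum_(0 <= n <oo) f n x)%E by exact: nneseries_ge0.
apply: (@le_trans _ _ (\int[Q]_x (\sum_(0 <= n <oo) f n x + cst (e m + e m)%:E x))%E).
  apply: ae_ge0_le_integral => //.
  - by move=> x _; rewrite lee_fin mdist_ge0.
  - exact: (measurable_emdist hX (mg j) (mg j')).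
  - by move=> x _; rewrite adde_ge0// lee_fin addr_ge0// ltW.
  - by apply: emeasurable_funD.
  - exists (~` good); split; [exact: measurableC|exact: good0|].
    by move=> x /= H gx; apply: H => _; exact: ptw.
rewrite ge0_integralD//; last by move=> x _; rewrite lee_fin addr_ge0// ltW.
apply: (@le_trans _ _ ((c + (e m + e m))%:E + (e m + e m)%:E)%E); last first.
  by rewrite -!EFinD lee_fin; lra.
apply: leeD; last exact: integral_cst_le.
rewrite integral_nneseries//; apply: lime_le.
  by apply: is_cvg_nneseries => n _ _; exact: integral_ge0.
apply: nearW => N; rewrite (eq_bigr (fun n => (wgt n * fine (Q (D n)))%:E)).
  by rewrite sumEFin lee_fin; exact: Hc.
move=> n _; rewrite ge0_integralZl ?lee_fin ?wgt_ge0//; last first.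
  by apply/measurable_EFinP.
by rewrite integral_indic// setIT EFinM fineK// fin_num_measure.
Qed.

End limit_process.

(** Bundles a process with its probability space, so that a sequence of processes living on
    different spaces can be chosen. *)
Record stage (R : realType) (X : completeMetricType R) (I : Type) := Stage {
  stage_disp : measure_display ;
  stage_space : measurableType stage_disp ;
  stage_prob : probability stage_space R ;
  stage_proc : I -> stage_space -> borel X }.

Arguments stage_proc {R X I} s _ _.
Arguments stage_prob {R X I} s.

Section discrete_process.
Context (R : realType) (X : completeMetricType R) (hX : separable_space X) (T : R).

(** At each point at most one pair event occurs, and then each centre is within [e] of the
    corresponding value of [f] or [f']. *)
Lemma pair_sum_le (xs : nat -> X) (e : R) d (S : measurableType d) (P : probability S R)
    (f f' : S -> borel X) (c : R) (N : nat) : 0 < e ->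
  measurable_fun setT f -> measurable_fun setT f' ->
  (\int[P]_x emdist (f x : X) (f' x) <= c%:E)%E ->
  \sum_(0 <= n < N) wgt xs n * fine (P (pair_event (fun i => f @^-1` cell xs e i)
     (fun i => f' @^-1` cell xs e i) n)) <= c + (e + e).
Proof.
move=> e0 mf mf' Hc.
set D := pair_event _ _.
have mc (g : S -> borel X) i : measurable_fun setT g -> measurable (g @^-1` cell xs e i).
  move=> mg; rewrite -[X in measurable X]setTI; apply: mg => //; exact: measurable_cell.
have mD n : measurable (D n).
  by rewrite /D /pair_event; case: pickle_inv => // p; apply: measurableI; exact: mc.
pose h n x := ((wgt xs n)%:E * (\1_(D n) x)%:E)%E.
have h0 n x : (0 <= h n x)%E by rewrite mule_ge0// lee_fin ?wgt_ge0.
have mh n : measurable_fun setT (h n).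
  by apply: measurable_funeM; apply/measurable_EFinP.
have hD n : (\int[P]_x h n x = (wgt xs n * fine (P (D n)))%:E)%E.
  rewrite ge0_integralZl ?lee_fin ?wgt_ge0//; last by apply/measurable_EFinP.
  by rewrite integral_indic// setIT EFinM fineK// fin_num_measure.
rewrite -lee_fin -sumEFin -(eq_bigr _ (fun n _ => hD n)) -ge0_integral_sum//.
apply: (@le_trans _ _ (\int[P]_x (emdist (f x : X) (f' x) + cst (e + e)%:E x))%E).
  apply: ge0_le_integral => //.
  - by move=> x _; exact: sume_ge0.
  - exact: emeasurable_sum.
  - by apply: emeasurable_funD => //; exact: measurable_emdist.
  move=> x _; rewrite -EFinD.
  have [n0 Hn0] : exists n0, forall n, D n x -> n = n0.
    have [[n0 Dn0]|nD] := pselect (exists n, D n x); last first.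
      by exists 0%N => n Dn; exfalso; apply: nD; exists n.
    exists n0 => n; move: Dn0; rewrite /D /pair_event.
    case En0 : (pickle_inv n0) => [p|] //; case En : (pickle_inv n) => [p'|] //.
    move=> [/= p1 p2] [/= p1' p2'].
    have := @pickle_invK (nat * nat)%type n; have := @pickle_invK (nat * nat)%type n0.
    rewrite /= En En0 /= => <- <-; congr (pickle _).
    by move: p p' p1 p2 p1' p2' {En En0} => [a b] [a' b'] /= p1 p2 p1' p2';
      rewrite (cell_uniq p1 p1') (cell_uniq p2 p2').
  have B0 : 0 <= mdist (f x : X) (f' x) + (e + e) by rewrite addr_ge0 ?mdist_ge0// ltW// addr_gt0.
  have hB : h n0 x = 0%E \/ (h n0 x <= (mdist (f x : X) (f' x) + (e + e))%:E)%E.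
    rewrite /h; have [Dx|nDx] := pselect (D n0 x); last first.
      by left; rewrite indicE memNset//= mule0.
    right; rewrite indicE mem_set//= mule1 lee_fin.
    move: Dx; rewrite /D /pair_event /wgt; case: pickle_inv => // -[i i'] [/= [d1 _] [d2 _]].
    have := metric_triangle (xs i) (f x) (xs i'); have := metric_triangle (f x : X) (f' x) (xs i').
    rewrite (metric_sym (xs i) (f x)); move: d1 d2; lra.
  have hz n : n != n0 -> h n x = 0%E.
    move=> nn0; rewrite /h indicE; case: (boolP (x \in D n)) => [/set_mem /Hn0 nn|_]; last by rewrite mule0.
    by rewrite nn eqxx in nn0.
  apply: (@le_trans _ _ (\sum_(0 <= n < N | n == n0) h n x)%E).
    rewrite [leRHS]big_mkcond; apply: lee_sum => n _.
    by case: ifPn => // /hz ->.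
  rewrite big_nat1_eq; case: ifP => _; last by rewrite lee_fin.
  by case: hB => [->|//]; rewrite lee_fin.
rewrite ge0_integralD//.
- by rewrite [leRHS]EFinD; apply: leeD => //; exact: integral_cst_le.
- by move=> x _; rewrite lee_fin mdist_ge0.
- exact: measurable_emdist.
- by move=> x _; rewrite lee_fin ltW// addr_gt0.
Qed.

Context (mu : time T -> probability (borel X) R) (V : time T -> R).
Hypothesis HV : forall s t : time T, val s < val t -> (W1 (mu s) (mu t) <= (V t - V s)%:E)%E.

(** The slack [(t j - t i) / k.+1] makes the bound on [W1] strict, as [chain] requires; it is an
    increment of a function of time, so it can be added to [V], and it vanishes as [k] grows. *)
Definition stage_ok (t : nat -> time T) (k : nat) (st : stage X (time T)) : Prop :=
  [/\ (forall s, measurable_fun setT (stage_proc st s)),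
    (forall j, (j <= k)%N -> forall B : set (borel X), measurable B ->
       stage_prob st (stage_proc st (t j) @^-1` B) = mu (t j) B) &
    (forall i j, (i <= k)%N -> (j <= k)%N -> val (t i) < val (t j) ->
       (\int[stage_prob st]_x emdist (stage_proc st (t i) x : X) (stage_proc st (t j) x)
         <= (V (t j) - V (t i) + (val (t j) - val (t i)) / k.+1%:R)%:E)%E)].

Lemma stages_exist (t : nat -> time T) : exists st : nat -> stage X (time T),
  forall k, stage_ok t k (st k).
Proof.
suff H k : exists st, stage_ok t k st.
  by exists (fun k => projT1 (cid (H k))) => k; exact: projT2 (cid (H k)).
have Hk (s u : time T) : val s < val u ->
    (W1 (mu s) (mu u) < ((V u + val u / k.+1%:R) - (V s + val s / k.+1%:R))%:E)%E.
  move=> su; apply: (le_lt_trans (HV su)); rewrite lte_fin.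
  have : 0 < (val u - val s) / k.+1%:R by rewrite divr_gt0// subr_gt0.
  by rewrite mulrBl opprD addrACA ltrDl.
have [l sl lE] := sorted_times [seq t j | j <- iota 0 k.+1].
have [d [S [P [Y [mY YE YI]]]]] := chain hX Hk sl.
have tl j : (j <= k)%N -> t j \in l.
  by move=> jk; rewrite lE; apply/mapP; exists j; rewrite // mem_iota.
exists (Stage P Y); split => //= [j jk|i j ik jk ij].
  exact/YE/tl.
apply: le_trans (YI _ _ (tl i ik) (tl j jk) ij) _.
by rewrite lee_fin mulrBl opprD addrACA.
Qed.

Lemma discrete_process (t : nat -> time T) :
  exists d (S : measurableType d) (Q : probability S R) (g : nat -> S -> borel X),
  [/\ (forall j, measurable_fun setT (g j)),
      (forall j (B : set (borel X)), measurable B -> Q (g j @^-1` B) = mu (t j) B) &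
      (forall i j, val (t i) < val (t j) ->
        (\int[Q]_x emdist (g i x : X) (g j x) <= (V (t j) - V (t i))%:E)%E)].
Proof.
have [st Hst] := stages_exist t.
have [xs xsP] := dense_seq_exists hX.
(* A partition number encodes a time index and a mesh; a number encoding no pair merely repeats the
   partition of [(0, 0)]. *)
pose jm (a : nat) : nat * nat := odflt (0, 0)%N (unpickle a).
have jmK p : jm (pickle p) = p by rewrite /jm pickleK.
pose e m : R := m.+1%:R^-1.
have e0 m : 0 < e m by rewrite invr_gt0.
pose C (k a i : nat) := stage_proc (st k) (t (jm a).1) @^-1` cell xs (e (jm a).2) i.
have mC k a i : measurable (C k a i).
  have [mY _ _] := Hst k.
  by rewrite -[X in measurable X]setTI; apply: mY => //; exact: measurable_cell.
have tC k a : trivIset setT (C k a).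
  by move=> i i' _ _ [x [xi xi']]; exact: (cell_uniq xi xi').
have [U [UU sU [Q [A [mA tA AC]]]]] := partitions_limit (fun k => stage_prob (st k)) mC tC.
have PU : ProperFilter U by exact: ultra_proper.
pose A' (j m i : nat) := A (pickle (j, m)) i.
have CE (k j m i : nat) : C k (pickle (j, m)) i = stage_proc (st k) (t j) @^-1` cell xs (e m) i.
  by rewrite /C jmK.
have fin_inj (x y : \bar R) : x \is a fin_num -> y \is a fin_num -> fine x = fine y -> x = y.
  by move=> xf yf E; rewrite -(fineK xf) E fineK.
have fine_cvg_unique (u : nat -> R) (a b : R) : u @ U --> a -> U (fun k => u k = b) -> a = b.
  move=> ua ub; have vb : u @ U --> b by exact: cvg_near_cst.
  by transitivity (lim (u @ U)); [apply/esym|]; exact: cvg_lim.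
have Unear (F : nat -> Prop) N : (forall k, (N <= k)%N -> F k) -> U F.
  by move=> HF; apply: sU; exists N.
(* For [k >= j] the chain of stage [k] has the prescribed marginal at [t j], so the converging
   probabilities are eventually constant. *)
have HA1 j m i : Q (A' j m i) = mu (t j) (cell xs (e m) i).
  have := AC (pickle (j, m)) i (pickle (j, m)) i; rewrite setIid => H.
  suff E : fine (Q (A' j m i)) = fine (mu (t j) (cell xs (e m) i)).
    have mc := @measurable_cell _ _ xs (e m) i.
    apply: fin_inj; [by apply: fin_num_measure; exact: mA|exact: fin_num_measure|].
    exact: E.
  apply: fine_cvg_unique; [exact: H|]; apply: (Unear _ j) => k jk /=.
  have [_ YE _] := Hst k.
  by rewrite setIid CE (YE _ jk)//; exact: measurable_cell.
have HA2 j m i m' i' : e m + e m' <= mdist (xs i) (xs i') ->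
    Q (A' j m i `&` A' j m' i') = 0%E.
  move=> H; have := AC (pickle (j, m)) i (pickle (j, m')) i' => HC.
  suff E : fine (Q (A' j m i `&` A' j m' i')) = 0.
    apply: fin_inj; [|by []|exact: E].
    by apply: fin_num_measure; exact: (measurableI _ _ (mA _ _) (mA _ _)).
  apply: fine_cvg_unique; [exact: HC|]; apply: (Unear _ 0%N) => k _.
  rewrite !CE (_ : _ `&` _ = set0) ?measure0//.
  apply/seteqP; split => // x [[/= d1 _] [d2 _]]; move: H; rewrite leNgt => /negP; apply.
  by apply: le_lt_trans (metric_triangle _ (stage_proc (st k) (t j) x : X) _) _;
    rewrite metric_sym ltrD.
have [g [mg gE gI]] := @limit_process_exists R X hX xs xsP _ _ Q A' (fun j => mu (t j))
  (fun j m i => mA _ i) (fun j m => tA _) HA1 HA2.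
exists _, _, Q, g; split => // i j ij; apply: gI => m N.
pose u k := \sum_(0 <= n < N) wgt xs n *
  fine (stage_prob (st k) (pair_event (C k (pickle (i, m))) (C k (pickle (j, m))) n)).
have ucvg : u @ U --> \sum_(0 <= n < N) wgt xs n * fine (Q (pair_event (A' i m) (A' j m) n)).
  rewrite /u; elim: (N) => [|N' IH].
    by rewrite big_nil; under eq_fun do rewrite big_nil; exact: cvg_cst.
  rewrite big_nat_recr//=; under eq_fun do rewrite big_nat_recr//=.
  apply: cvgD => //; apply: cvgMr; rewrite /pair_event.
  case: pickle_inv => [p|]; first exact: AC.
  rewrite measure0; under eq_fun do rewrite measure0; exact: cvg_cst.
(* Mesh [m] and truncation [N] are fixed while [k] grows; [N0] is chosen so that the slack is then
   at most [r]. *)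
apply/ler_addgt0Pr => r r0; apply: (cvgr_to_le ucvg).
have T0 : 0 < val (t j) - val (t i) by rewrite subr_gt0.
pose N0 := Num.truncn ((val (t j) - val (t i)) / r).
apply: (Unear _ (maxn (maxn i j) N0)) => k; rewrite !geq_max => /andP[/andP[ik jk] Nk].
have [mY _ YI] := Hst k.
have := @pair_sum_le xs (e m) _ _ (stage_prob (st k)) _ _ _ N (e0 m) (mY (t i)) (mY (t j)) (YI i j ik jk ij).
have -> : (fun i0 => stage_proc (st k) (t i) @^-1` cell xs (e m) i0) = C k (pickle (i, m)).
  by apply/funext => i0; rewrite CE.
have -> : (fun i0 => stage_proc (st k) (t j) @^-1` cell xs (e m) i0) = C k (pickle (j, m)).
  by apply/funext => i0; rewrite CE.
move=> /le_trans; apply.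
have : (val (t j) - val (t i)) / k.+1%:R <= r.
  rewrite ler_pdivrMr// mulrC -ler_pdivrMr//; apply/ltW/(lt_le_trans (truncnS_gt _)).
  by rewrite ler_nat ltnS.
rewrite /e.
move: ((val (t j) - val (t i)) / k.+1%:R) (m.+1%:R^-1 : R) => w v; lra.
Qed.

End discrete_process.

(** * Right limits *)

Section regularize.
Context (R : realType) (X : completeMetricType R) (T : R) (D : set (time T)).
Hypothesis D_between : forall a b : R, 0 <= a -> a < b -> b <= T ->
  exists2 s, D s & a < val s < b.

(** The sequence depends on [t] only. Used for all paths at once, it makes the right limit at [t] a
    pointwise limit of random variables, hence measurable. *)
Lemma right_sequence (t : time T) : exists tau : nat -> time T,
  [/\ (forall n, D (tau n)), (forall n, val t < val (tau n)) &
      (forall y : R, val t < y -> \forall n \near \oo, val (tau n) < y)].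
Proof.
have /andP[t0 tT] := valP t.
have /choice[tau Htau] : forall n : nat, exists s : time T,
    D s /\ val t < val s < Num.min T (val t + n.+1%:R^-1).
  move=> n; have lt : val t < Num.min T (val t + n.+1%:R^-1).
    by rewrite lt_min tT ltrDl invr_gt0 ltr0n.
  have mT : Num.min T (val t + n.+1%:R^-1) <= T by rewrite ge_min lexx.
  have [s Ds st] := D_between (ltW t0) lt mT.
  by exists s.
exists tau; split=> [n|n|y ty]; first by have [] := Htau n.
  by have [_ /andP[]] := Htau n.
have yt : 0 < y - val t by rewrite subr_gt0.
apply: filterS (near_infty_natSinv_lt (PosNum yt)) => n /= ny.
have [_ /andP[_]] := Htau n; rewrite lt_min => /andP[_] /lt_trans; apply.
by rewrite -ltrBrDl.
Qed.

Context (h : time T -> X).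
Hypothesis hv : (curve_var (@emdist R X) h D < +oo)%E.

Let hd := ext_dist_emdist X.

Let F (x : R) : R := fine (curve_var (@emdist R X) h (D `&` [set t | val t <= x])).

Let Fvar x : (F x)%:E = curve_var (@emdist R X) h (D `&` [set t | val t <= x]).
Proof.
rewrite fineK// ge0_fin_numE ?curve_var_ge0//.
by apply: le_lt_trans hv; apply: curve_varS => t [].
Qed.

Let F_nd x y : x <= y -> F x <= F y.
Proof.
move=> xy; rewrite -lee_fin !Fvar; apply: curve_varS => t [Dt] /= tx.
by split => //=; exact: le_trans xy.
Qed.

Let F_ge0 x : 0 <= F x.
Proof. by rewrite -lee_fin Fvar curve_var_ge0. Qed.

Let F_dist s u : D s -> D u -> val s < val u -> mdist (h s) (h u) <= F (val u) - F (val s).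
Proof.
move=> Ds Du su; rewrite lerBrDl -lee_fin EFinD !Fvar.
exact: (curve_var_dist_le hd).
Qed.

(** The right limit of the nondecreasing [F] at [t]. The regularized curve satisfies
    [mdist (g t) (g u) <= G u - G t] for [t] before [u], which yields right continuity, left limits
    and the bound on the variation. *)
Let G (t : time T) : R := inf [set F y | y in [set y : R | val t < y]].

Let G_has_inf (t : time T) : has_inf [set F y | y in [set y : R | val t < y]].
Proof.
split; first by exists (F (val t + 1)), (val t + 1); rewrite //= ltrDl.
by exists 0 => _ [y _ <-].
Qed.

Let G_le (t : time T) (y : R) : val t < y -> G t <= F y.
Proof. by move=> ty; apply: ge_inf; [exact: (G_has_inf t).2|exists y]. Qed.

Let G_ge0 t : 0 <= G t.
Proof. by apply: lb_le_inf; [exact: (G_has_inf t).1|move=> _ [y _ <-]]. Qed.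

Let G_adherent (t : time T) (e : R) : 0 < e -> exists2 y, val t < y & F y < G t + e.
Proof. by move=> e0; have [_ [y ty <-] Fy] := inf_adherent e0 (G_has_inf t); exists y. Qed.

Context (tau : time T -> nat -> time T).
Hypothesis tauD : forall t n, D (tau t n).
Hypothesis tau_gt : forall t n, val t < val (tau t n).
Hypothesis tau_cvg : forall (t : time T) (y : R), val t < y -> \forall n \near \oo, val (tau t n) < y.

Let F_dist' s u : D s -> D u -> mdist (h s) (h u) <= `|F (val u) - F (val s)|.
Proof.
move=> Ds Du; have [->|] := eqVneq s u; first by rewrite mdistxx.
move=> /tlt_total/orP[su|us].
  by apply: le_trans (F_dist Ds Du su) _; exact: ler_norm.
by rewrite metric_sym distrC; apply: le_trans (F_dist Du Ds us) _; exact: ler_norm.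
Qed.

Let lim_exists t : exists y : X, mdist (h (tau t n)) y @[n --> \oo] --> (0 : R).
Proof.
have cu : cauchy ((fun n => h (tau t n)) @ \oo).
  apply: cauchy_exP => r r0.
  have [y ty Fy] := G_adherent t r0.
  have [N _ HN] := tau_cvg ty.
  exists (h (tau t N)); exists N => // n Nn /=; rewrite ballEmdist /=.
  apply: (le_lt_trans (F_dist' _ _)) => //.
  have H1 := HN _ Nn; have H2 := HN N (leqnn _).
  have := F_nd (ltW H1); have := F_nd (ltW H2).
  have := G_le (tau_gt t n); have := G_le (tau_gt t N).
  by rewrite ltr_norml /=; lra.
have /cvg_ex[y uy] : cvg ((fun n => h (tau t n)) @ \oo) by exact: cauchy_cvg.
exists y; apply/cvgrPdist_lt => e e0.
have : \forall n \near \oo, ball y e (h (tau t n)) by exact: uy _ (nbhsx_ballx y _ e0).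
apply: filterS => n; rewrite /= ballEmdist /= metric_sym.
by rewrite sub0r normrN ger0_norm ?mdist_ge0.
Qed.

Lemma regularize : exists g : time T -> X,
  [/\ cadlag (@emdist R X) g,
      (forall t, mdist (h (tau t n)) (g t) @[n --> \oo] --> (0 : R)) &
      (forall b : R, b <= T -> (curve_var (@emdist R X) g [set t | (val t < b)%R] <=
         curve_var (@emdist R X) h (D `&` [set t | (val t < b)%R]))%E)].
Proof.
have /choice[g Hg] := lim_exists.
exists g.
have G3 s t : D s -> val t < val s -> mdist (h s) (g t) <= F (val s) - G t.
  move=> Ds ts; have c := @cvg_mdist _ X (fun n => h (tau t n)) (g t) (h s) (Hg t).
  rewrite metric_sym; apply: (cvgr_to_le c).
  apply: filterS (tau_cvg ts) => n ns; rewrite metric_sym in ns *.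
  rewrite metric_sym; apply: le_trans (F_dist (tauD t n) Ds ns) _.
  by rewrite lerB// G_le.
have G4 (t u : time T) : val t < val u -> mdist (g t) (g u) <= G u - G t.
  move=> tu; apply/ler_addgt0Pr => e e0.
  have e20 : 0 < e / 2 by rewrite divr_gt0.
  have [y uy Fy] := G_adherent u e20.
  have := Hg u => /cvgrPdist_lt /(_ _ e20) H.
  have [n []] := filter_ex (filterI H (tau_cvg uy)).
  rewrite /= sub0r normrN ger0_norm ?mdist_ge0// => h1 h2.
  have := G3 (tau u n) t (tauD u n) (lt_trans tu (tau_gt u n)).
  have := metric_triangle (g t) (h (tau u n)) (g u).
  have := F_nd (ltW h2); rewrite (metric_sym (g t) (h _)); lra.
split => //.
- move=> t; have /andP[t0 tT] := valP t; split.
    move=> e e0; have [y ty Fy] := G_adherent t e0.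
    near=> r => s sr; rewrite lte_fin metric_sym.
    have ts : val t < val s by rewrite sr; near: r; exact: nbhs_right_gt.
    have sy : val s < y by rewrite sr; near: r; exact: nbhs_right_lt.
    by have := G4 t s ts; have := G_le sy; lra.
  (* [G] is bounded and increases towards [sup E] on the left of [t]. Times where [G] is within
     [1 / n.+1] of [sup E] give a sequence to which [fast_cauchy_lim] applies. *)
  pose E := [set G s | s in [set s : time T | val s < val t]].
  have hE : has_sup E.
    split; last by exists (F T) => _ [s _ <-]; apply: G_le; case/andP: (valP s).
    have [s Ds /andP[s0 st]] := D_between (lexx 0) t0 (ltW tT).
    by exists (G s), s.
  have /choice[sg Hsg] : forall n : nat, exists s : time T, val s < val t /\ sup E - n.+1%:R^-1 < G s.
    move=> n; have n0 : 0 < n.+1%:R^-1 :> R by rewrite invr_gt0.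
    by have [_ [s st <-] Gs] := sup_adherent n0 hE; exists s.
  have GE (s : time T) : val s < val t -> G s <= sup E.
    by move=> st; apply: ub_le_sup; [exact: hE.2|exists s].
  have G4' s u : mdist (g s) (g u) <= `|G u - G s|.
    have [->|] := eqVneq s u; first by rewrite mdistxx.
    move=> /tlt_total/orP[su|us]; first by apply: le_trans (G4 _ _ su) _; exact: ler_norm.
    by rewrite metric_sym distrC; apply: le_trans (G4 _ _ us) _; exact: ler_norm.
  have [y Hy] : exists y, forall m, mdist (g (sg m)) y <= m.+1%:R^-1.
    apply: (@fast_cauchy_lim R X (fun n => g (sg n))) => m m'.
    apply: (le_lt_trans (G4' _ _)).
    have [st1 H1] := Hsg m; have [st2 H2] := Hsg m'.
    have := GE _ st1; have := GE _ st2.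
    have i1 : 0 < m.+1%:R^-1 :> R by rewrite invr_gt0.
    have i2 : 0 < m'.+1%:R^-1 :> R by rewrite invr_gt0.
    by rewrite ltr_norml; move: (m.+1%:R^-1 : R) (m'.+1%:R^-1 : R) i1 i2 H1 H2 => a b; lra.
  exists y => e e0; have e20 : 0 < e / 2 by rewrite divr_gt0.
  have [m _ /(_ m (leqnn _)) /= me] := near_infty_natSinv_lt (PosNum e20).
  have [sm Hm] := Hsg m.
  near=> r => s sr; rewrite lte_fin; change (val s = r) in sr.
  have st : val s < val t by rewrite sr; near: r; exact: nbhs_left_lt.
  have ms : val (sg m) < val s by rewrite sr; near: r; exact: nbhs_left_gt.
  have := G4 _ _ ms; have := metric_triangle (g s) (g (sg m)) y; have := Hy m.
  have := GE _ st; rewrite (metric_sym (g s) (g (sg m))).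
  by move: (m.+1%:R^-1 : R) me Hm => a; lra.
- move=> b bT; apply: curve_var_le => l sl lb.
  have bound t l' : path (@tlt R T) t l' ->
      (vsum (@emdist R X) g (t :: l') <= (G (last t l') - G t)%:E)%E.
    elim: l' t => [|u l' IH] t; first by rewrite vsum1 subrr.
    move=> /= /andP[tu pl]; rewrite vsum_cons2.
    apply: (@le_trans _ _ ((G u - G t)%:E + (G (last u l') - G u)%:E)%E).
      by apply: leeD; [rewrite lee_fin G4|exact: IH].
    by rewrite -EFinD lee_fin; lra.
  case: l sl lb => [|t l] sl lb; first by rewrite vsum_nil curve_var_ge0.
  apply: le_trans (bound _ _ sl) _.
  have lastb : val (last t l) < b by apply: lb; rewrite mem_last.
  have /andP[l0 _] := valP (last t l).
  (* [G] looks to the right of the last time; as that time is strictly before [b], a time [s] of [D]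
     fits in between and [G] there is at most [F (val s)]. *)
  have [s Ds /andP[ls sb]] := D_between (ltW l0) lastb bT.
  apply: (@le_trans _ _ (F (val s))%:E).
    by rewrite lee_fin; have := G_ge0 t; have := G_le ls; lra.
  rewrite Fvar; apply: curve_varS => u [Du] /= us; split => //=.
  exact: le_lt_trans sb.
Unshelve. all: by end_near. Qed.

End regularize.

Lemma dense_times (R : realType) (T : R) : 0 < T -> exists t : nat -> time T,
  forall a b : R, 0 <= a -> a < b -> b <= T ->
    exists2 s, range t s & a < val s < b.
Proof.
move=> T0.
have mid : 0 < T / 2 < T by lra.
pose s0 : time T := exist _ (T / 2) mid.
(* Enumerates the rational times; a code yielding no rational of []0, T[] falls back on the
   midpoint. *)
pose t (j : nat) : time T := xget s0 [set s : time T | val s = ratr (odflt 0 (@unpickle rat j))].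
exists t => a b a0 ab bT.
have [q] := rat_in_itvoo ab; rewrite in_itv/= => /andP[aq qb].
have [s sE] := @time_of_real R T (ratr q) (introT andP (conj (le_lt_trans a0 aq) (lt_le_trans qb bT))).
exists s; last by rewrite sE aq.
exists (pickle q) => //; rewrite /t pickleK /=.
case: xgetP => [s' _ /= s'E|/(_ s)/=]; last by rewrite sE.
by apply: val_inj; exact: (etrans s'E (esym sE)).
Qed.

(** * Variation along countably many times, and its expectation *)

Section enumeration.
Context (R : realType) (T : R) (t : nat -> time T).

(** Along these growing finite sets the sums increase to the variation, which gives both its
    measurability in the path and access to monotone convergence. *)
Lemma sorted_prefixes : exists L : nat -> seq (time T),
  (forall k, sorted (@tlt R T) (L k)) /\
  (forall k s, (s \in L k) = (s \in [seq t j | j <- iota 0 k])).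
Proof.
have /choice[L HL] : forall k, exists l, sorted (@tlt R T) l /\ l =i [seq t j | j <- iota 0 k].
  by move=> k; have [l sl lE] := sorted_times [seq t j | j <- iota 0 k]; exists l.
by exists L; split => k; have [] := HL k.
Qed.

Context (L : nat -> seq (time T)).
Hypothesis sL : forall k, sorted (@tlt R T) (L k).
Hypothesis LE : forall k s, (s \in L k) = (s \in [seq t j | j <- iota 0 k]).

Lemma mem_prefixP k s : reflect (exists2 j, (j < k)%N & s = t j) (s \in L k).
Proof.
rewrite LE; apply: (iffP mapP) => [[j]|[j jk ->]].
  by rewrite mem_iota add0n => /andP[_ jk] ->; exists j.
by exists j => //; rewrite mem_iota.
Qed.

Lemma prefix_filter_sub (p : pred (time T)) i k : (i <= k)%N ->
  {subset [seq s <- L i | p s] <= [seq s <- L k | p s]}.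
Proof.
move=> ik s; rewrite !mem_filter => /andP[-> /mem_prefixP[j ji ->]] /=.
by apply/mem_prefixP; exists j => //; exact: leq_trans ik.
Qed.

Context (Y : Type) (dist : Y -> Y -> \bar R) (hd : ext_dist dist).

Lemma vsum_prefix_nd (g : time T -> Y) (p : pred (time T)) :
  nondecreasing_seq (fun k => vsum dist g [seq s <- L k | p s]).
Proof.
move=> i k ik; apply: (vsum_subset hd); last exact: prefix_filter_sub.
- exact: (sorted_filter (@tlt_trans R T)).
- exact: (sorted_filter (@tlt_trans R T)).
Qed.

Lemma curve_var_enum (g : time T -> Y) (p : pred (time T)) :
  vsum dist g [seq s <- L k | p s] @[k --> \oo] -->
  curve_var dist g (range t `&` [set s | p s]).
Proof.
have := ereal_nondecreasing_cvgn (vsum_prefix_nd g p).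
rewrite (_ : ereal_sup _ = curve_var dist g (range t `&` [set s | p s]))//.
apply/eqP; rewrite eq_le; apply/andP; split.
  apply: ge_ereal_sup => _ [k _ <-]; apply: vsum_le_curve_var.
    exact: (sorted_filter (@tlt_trans R T)).
  by move=> s; rewrite mem_filter => /andP[ps /mem_prefixP[j _ sj]]; split => //; exists j.
apply: curve_var_le => l sl lp.
have [k Hk] : exists k, {subset l <= L k}.
  elim: l lp {sl} => [|s l IH] lp; first by exists 0%N.
  have [k Hk] := IH (fun u ul => lp u (mem_behead (s := s :: l) ul)).
  have [[j _ tj] _] := lp s (mem_head _ _).
  exists (maxn j.+1 k) => u; rewrite inE => /orP[/eqP ->|/Hk /mem_prefixP[j' j'k ->]].
    by apply/mem_prefixP; exists j; rewrite ?leq_maxl.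
  by apply/mem_prefixP; exists j' => //; rewrite (leq_trans j'k)// leq_maxr.
apply: (@le_trans _ _ (vsum dist g [seq s <- L k | p s])).
  apply: (vsum_subset hd) => //; first exact: (sorted_filter (@tlt_trans R T)).
  by move=> s sl'; rewrite mem_filter Hk// andbT; have [] := lp s sl'.
by apply: ereal_sup_ubound; exists k.
Qed.

End enumeration.

Section random_variation.
Context (R : realType) (X : completeMetricType R) (hX : separable_space X) (T : R).
Context d (S : measurableType d).

Lemma measurable_vsum (h : S -> time T -> X) (l : seq (time T)) :
  (forall s, s \in l -> measurable_fun setT ((fun x => h x s) : S -> borel X)) ->
  measurable_fun setT (fun x => vsum (@emdist R X) (h x) l).
Proof.
elim: l => [|s [|u l] IH] mh.
- rewrite (_ : (fun x => _) = cst 0%E); first exact: measurable_cst.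
  by apply/funext => x; rewrite vsum_nil.
- rewrite (_ : (fun x => _) = cst 0%E); first exact: measurable_cst.
  by apply/funext => x; rewrite vsum1.
rewrite (_ : (fun x => _) = (fun x => emdist (h x s) (h x u) + vsum (@emdist R X) (h x) (u :: l))%E); last first.
  by apply/funext => x; rewrite vsum_cons2.
apply: emeasurable_funD.
  by apply: (measurable_emdist hX); apply: mh; rewrite !inE eqxx ?orbT.
by apply: IH => v vl; apply: mh; rewrite inE vl orbT.
Qed.

Lemma measurable_curve_var_enum (t : nat -> time T) (h : S -> time T -> X) (p : pred (time T)) :
  (forall j, measurable_fun setT ((fun x => h x (t j)) : S -> borel X)) ->
  measurable_fun setT (fun x => curve_var (@emdist R X) (h x) (range t `&` [set s | p s])).
Proof.
move=> mh; have [L [sL LE]] := sorted_prefixes t.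
apply: (emeasurable_fun_cvg (fun k x => vsum (@emdist R X) (h x) [seq s <- L k | p s])).
  move=> k; apply: measurable_vsum => s; rewrite mem_filter => /andP[_ /(mem_prefixP LE)[j _ ->]].
  exact: mh.
by move=> x _; exact: (curve_var_enum sL LE (ext_dist_emdist X)).
Qed.

Context (P : probability S R).

Lemma integral_vsum (h : S -> time T -> X) (l : seq (time T)) :
  (forall s, s \in l -> measurable_fun setT ((fun x => h x s) : S -> borel X)) ->
  (\int[P]_x vsum (@emdist R X) (h x) l =
   \sum_(p <- zip l (behead l)) \int[P]_x emdist (h x p.1) (h x p.2))%E.
Proof.
elim: l => [|s [|u l] IH] mh.
- by rewrite big_nil; under eq_integral do rewrite vsum_nil; rewrite integral0.
- by rewrite big_nil; under eq_integral do rewrite vsum1; rewrite integral0.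
rewrite /= big_cons /= -IH => [|v vl]; last by apply: mh; rewrite inE vl orbT.
under eq_integral do rewrite vsum_cons2.
rewrite ge0_integralD//.
- by move=> x _; rewrite lee_fin mdist_ge0.
- by apply: (measurable_emdist hX); apply: mh; rewrite !inE eqxx ?orbT.
- by move=> x _; exact: (vsum_ge0 (ext_dist_emdist X)).
- by apply: measurable_vsum => v vl; apply: mh; rewrite inE vl orbT.
Qed.

(* Nonoptimal couplings only increase the variation. *)
Lemma W1_var_le (mu : time T -> probability (borel X) R) (h : S -> time T -> X) (A : set (time T)) :
  (forall s, measurable_fun setT ((fun x => h x s) : S -> borel X)) ->
  (forall s (B : set (borel X)), measurable B -> P ((fun x => h x s) @^-1` B) = mu s B) ->
  measurable_fun setT (fun x => curve_var (@emdist R X) (h x) A) ->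
  (curve_var (@W1 R X) mu A <= \int[P]_x curve_var (@emdist R X) (h x) A)%E.
Proof.
move=> mh hE mA; apply: curve_var_le => l sl lA.
apply: (@le_trans _ _ (\int[P]_x vsum (@emdist R X) (h x) l)%E).
  rewrite integral_vsum//; apply: lee_sum => p _.
  exact: (W1_le_law hX (mh _) (mh _) (hE _) (hE _)).
apply: ge0_le_integral => //.
- by move=> x _; exact: (vsum_ge0 (ext_dist_emdist X)).
- exact: measurable_vsum.
- by move=> x _; exact: vsum_le_curve_var.
Qed.

Lemma integral_vsum_le (V : time T -> R) (h : S -> time T -> X) (D : set (time T))
    (s : time T) (l : seq (time T)) :
  (forall s, D s -> measurable_fun setT ((fun x => h x s) : S -> borel X)) ->
  (forall s u, D s -> D u -> val s < val u ->
     (\int[P]_x emdist (h x s) (h x u) <= (V u - V s)%:E)%E) ->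
  path (@tlt R T) s l -> (forall u, u \in s :: l -> D u) ->
  (\int[P]_x vsum (@emdist R X) (h x) (s :: l) <= (V (last s l) - V s)%:E)%E.
Proof.
move=> mh hV pl lD; rewrite integral_vsum; last by move=> u /lD; exact: mh.
elim: l s pl lD => [|u l IH] s; first by rewrite big_nil subrr.
move=> /= /andP[su pl] lD; rewrite big_cons /=.
have -> : (V (last u l) - V s)%:E = ((V u - V s)%:E + (V (last u l) - V u)%:E)%E.
  by rewrite -EFinD; congr (_%:E); ring.
apply: leeD; first by apply: hV => //; apply: lD; rewrite !inE eqxx ?orbT.
by apply: IH => // v vl; apply: lD; rewrite inE vl orbT.
Qed.

End random_variation.

(** Markov's inequality for a coupling of cost below [c]: if the first point is in [inner U r] and
    the second is not in [U], they are at distance at least [r]. *)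
Lemma W1_inner (R : realType) (X : completeMetricType R) (hX : separable_space X)
    (m m' : probability (borel X) R) (U : set X) (r c : R) :
  open U -> 0 < r -> (W1 m m' < c%:E)%E -> (m (inner U r) <= m' U + (c / r)%:E)%E.
Proof.
move=> oU r0 /ereal_inf_lt[_ [s cs <-] sc].
have mU : measurable (U : set (borel X)) by exact: measurable_open.
have mI : measurable (inner U r : set (borel X)) by apply: measurable_open; exact: open_inner.
have [<- _] := cs _ mI; have [_ <-] := cs _ mU; rewrite /pushforward.
pose E := [set z : borel X * borel X | r <= mdist (z.1 : X) z.2].
have md : measurable_fun setT (fun z : borel X * borel X => mdist (z.1 : X) z.2).
  by apply: (measurable_mdist hX); [exact: measurable_fst|exact: measurable_snd].
have mE : measurable E.
  rewrite (_ : E = (fun z : borel X * borel X => mdist (z.1 : X) z.2) @^-1` `[r, +oo[); last first.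
    by apply/seteqP; split => z; rewrite /E /= in_itv/= andbT.
  by rewrite -[X in measurable X]setTI; apply: md.
have m1 : measurable (fst @^-1` (inner U r : set (borel X)) : set (borel X * borel X)).
  by rewrite -[X in measurable X]setTI; exact: measurable_fst.
have m2 : measurable (snd @^-1` (U : set (borel X)) : set (borel X * borel X)).
  by rewrite -[X in measurable X]setTI; exact: measurable_snd.
apply: (@le_trans _ _ (s (snd @^-1` (U : set (borel X)) `|` E))).
  apply: le_measure; rewrite ?inE//; first exact: measurableU.
  move=> [x y] /= [e re He]; have [xy|xy] := ltP (mdist x y) e; first by left; exact: He.
  by right; rewrite /E /=; apply: ltW; exact: lt_le_trans xy.
apply: (le_trans (measureU2 _ _ _)) => //; apply: leeD => //.
rewrite -(@lee_pmul2l _ r%:E)// -EFinM (mulrC c) mulrA mulfV ?gt_eqF// mul1r.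
apply: le_trans (ltW sc).
apply: (@le_trans _ _ (\int[s]_z (r%:E * (\1_E z)%:E))%E).
  rewrite ge0_integralZl ?lee_fin ?(ltW r0)//; last by apply/measurable_EFinP.
  by rewrite integral_indic// setIT.
apply: ge0_le_integral => //.
- by move=> z _; rewrite -EFinM lee_fin mulr_ge0// ltW.
- by apply: measurable_funeM; apply/measurable_EFinP.
- by apply/measurable_EFinP.
move=> z _; rewrite -EFinM lee_fin indicE; case: (boolP (z \in E)) => [/set_mem Ez|_].
  by rewrite mulr1.
by rewrite mulr0 mdist_ge0.
Qed.

(** * Lifting curves of measures *)

Section lift.
Context (R : realType) (X : completeMetricType R) (hX : separable_space X).
Context (T : R) (hT : 0 < T).

Lemma itv_lt (b : R) : [set s : time T | (val s < b)%R] = [set s : time T | (0 < val s < b)%R].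
Proof.
by apply/seteqP; split => s /= sb; case/andP: (valP s) => s0 _; [rewrite s0|case/andP: sb].
Qed.

Lemma itv_ltT : [set s : time T | (val s < T)%R] = setT.
Proof. by rewrite itv_lt itv0T. Qed.

Lemma measurable_curve_var_itv d (S : measurableType d) (h : S -> time T -> X) (a b : R) :
  (forall x, right_cont (@emdist R X) (h x)) ->
  (forall s, measurable_fun setT ((fun x => h x s) : S -> borel X)) ->
  measurable_fun setT (fun x => curve_var (@emdist R X) (h x) [set s | (a < val s < b)%R]).
Proof.
move=> rh mh; have [t tD] := dense_times hT.
rewrite (_ : (fun x => _) = (fun x => curve_var (@emdist R X) (h x)
    (range t `&` [set s | (fun s : time T => a < val s < b) s]))).
  by apply: measurable_curve_var_enum => // j; exact: mh.
apply/funext => x; rewrite setIC.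
apply: (curve_var_rc_dense (ext_dist_emdist X) (rh x)); first exact: right_open_itv.
move=> s eta _ eta0; have /andP[s0 sT] := valP s.
have lt : val s < Num.min T (val s + eta) by rewrite lt_min sT ltrDl.
have mT : Num.min T (val s + eta) <= T by rewrite ge_min lexx.
have [u Du /andP[su uT]] := tD _ _ (ltW s0) lt mT; exists u => //.
by rewrite (ltW su)/= (lt_le_trans uT)// ge_min lexx orbT.
Qed.

Context (mu : time T -> probability (borel X) R).
Hypothesis hmu : bv_curve (@W1 R X) mu.

Let hW := ext_dist_W1 hX.
Let hE := ext_dist_emdist X.

Let cm : cadlag (@W1 R X) mu. Proof. by have [] := (bv_curveE hW mu).1 hmu. Qed.

Let fm : (curve_var (@W1 R X) mu setT < +oo)%E.
Proof. by have [] := (bv_curveE hW mu).1 hmu. Qed.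

(** The mass that the variation measure of [mu] gives to [(0, s]]. *)
Let V (s : time T) : R := fine (curve_var (@W1 R X) mu [set u | (val u <= val s)%R]).

Let VE s : (V s)%:E = curve_var (@W1 R X) mu [set u | (val u <= val s)%R].
Proof.
rewrite fineK// ge0_fin_numE ?curve_var_ge0//.
by apply: le_lt_trans fm; exact: curve_varS.
Qed.

Let V_W1 (s u : time T) : val s < val u -> (W1 (mu s) (mu u) <= (V u - V s)%:E)%E.
Proof.
move=> su; rewrite EFinB leeBrDl// !VE.
have := @curve_var_dist_le R T _ _ hW mu setT s u I I su.
by rewrite !setTI.
Qed.

(** For finitely many times before [b] the expected sum telescopes to an increment of [V], which the
    variation of [mu] before [b] dominates; monotone convergence removes the finiteness. *)
Lemma discrete_lift_var d (S : measurableType d) (Q : probability S R) (t : nat -> time T)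
    (h : S -> time T -> X) (b : R) :
  (forall s, measurable_fun setT ((fun x => h x s) : S -> borel X)) ->
  (forall s u, range t s -> range t u -> val s < val u ->
     (\int[Q]_x emdist (h x s) (h x u) <= (V u - V s)%:E)%E) ->
  (\int[Q]_x curve_var (@emdist R X) (h x) (range t `&` [set s | (val s < b)%R]) <=
     curve_var (@W1 R X) mu [set s | (val s < b)%R])%E.
Proof.
move=> mh hV; have [L [sL LE]] := sorted_prefixes t.
pose p (s : time T) := val s < b.
pose f k x := vsum (@emdist R X) (h x) [seq s <- L k | p s].
have mf k : measurable_fun setT (f k) by exact: measurable_vsum.
have fE x : curve_var (@emdist R X) (h x) (range t `&` [set s | p s]) = limn (f^~ x).
  by apply/esym/cvg_lim => //; exact: (curve_var_enum sL LE hE).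
under eq_integral do rewrite fE.
rewrite monotone_convergence//; last 2 first.
- by move=> k x _; exact: (vsum_ge0 hE).
- by move=> x _; exact: (vsum_prefix_nd sL LE hE).
apply: lime_le.
  apply: ereal_nondecreasing_is_cvgn => i k ik; apply: ge0_le_integral => //.
  - by move=> x _; exact: (vsum_ge0 hE).
  - by move=> x _; exact: (vsum_prefix_nd sL LE hE).
apply: nearW => k.
have sl : sorted (@tlt R T) [seq s <- L k | p s] by exact: (sorted_filter (@tlt_trans R T)).
have lD s : s \in [seq s <- L k | p s] -> range t s /\ val s < b.
  by rewrite mem_filter => /andP[ps /(mem_prefixP LE)[j _ sj]]; split; [exists j|exact: ps].
rewrite /f; case: [seq s <- L k | p s] sl lD => [|s l] sl lD.
  by under eq_integral do rewrite vsum_nil; rewrite integral0 curve_var_ge0.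
have := @integral_vsum_le R X hX T d S Q V h (range t) s l (fun s _ => mh s) hV sl
  (fun u ul => (lD u ul).1).
move=> /le_trans; apply; apply: (@le_trans _ _ (V (last s l))%:E).
  by rewrite lee_fin gerBl -lee_fin VE curve_var_ge0.
rewrite VE; apply: curve_varS => u /= ul; apply: (le_lt_trans ul).
by apply: (lD _ _).2; rewrite mem_last.
Qed.

Lemma lift_exists : exists d (S : measurableType d) (Q : probability S R) (g : S -> time T -> X),
  [/\ (forall x, cadlag (@emdist R X) (g x)),
      (forall x, (curve_var (@emdist R X) (g x) setT < +oo)%E),
      (forall s, measurable_fun setT ((fun x => g x s) : S -> borel X)),
      (forall s (B : set (borel X)), measurable B -> Q ((fun x => g x s) @^-1` B) = mu s B) &
      (forall b, b <= T -> (\int[Q]_x curve_var (@emdist R X) (g x) [set s | (val s < b)%R] <=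
         curve_var (@W1 R X) mu [set s | (val s < b)%R])%E)].
Proof.
have [t tD] := dense_times hT.
have [d [S [Q [g [mg gE gI]]]]] := discrete_process hX V_W1 t.
(* The enumeration [t] may repeat a time; choosing one index per time turns [g] into a function of
   the time. *)
pose idx (s : time T) := xget 0%N [set j | t j = s].
have tidx s : range t s -> t (idx s) = s.
  by move=> [j _ tj]; rewrite /idx; case: xgetP => [//|/(_ j)].
pose h x s : X := g (idx s) x.
have mh s : measurable_fun setT ((fun x => h x s) : S -> borel X) by exact: mg.
have lawh s (B : set (borel X)) : range t s -> measurable B -> Q ((fun x => h x s) @^-1` B) = mu s B.
  by move=> Ds mB; rewrite -[in RHS](tidx s Ds) -gE.
have hV s u : range t s -> range t u -> val s < val u ->
    (\int[Q]_x emdist (h x s) (h x u) <= (V u - V s)%:E)%E.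
  move=> Ds Du su; have := gI (idx s) (idx u).
  by rewrite (tidx s Ds) (tidx u Du) => /(_ su).
have est b := @discrete_lift_var d S Q t h b mh hV.
pose f x := curve_var (@emdist R X) (h x) (range t `&` [set s : time T | (val s < T)%R]).
have mf : measurable_fun setT f.
  exact: (@measurable_curve_var_enum R X hX T d S t h (fun s => val s < T)).
have f0 x : (0 <= f x)%E by exact: curve_var_ge0.
pose good := [set x | (f x < +oo)%E].
have mgood : measurable good.
  rewrite -[X in measurable X]setTI.
  by apply: (measurable_lte measurableT mf); exact: measurable_cst.
have good0 : Q (~` good) = 0%E.
  have intf : Q.-integrable setT f.
    apply/integrableP; split => //.
    under eq_integral do rewrite gee0_abs//.
    by apply: le_lt_trans (est T) _; rewrite itv_ltT.
  have [N [mN N0 sN]] := integrable_ae measurableT intf.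
  apply/eqP; rewrite eq_le measure_ge0 andbT -N0.
  apply: le_measure; rewrite ?inE//; first exact: measurableC.
  move=> x ngx; apply: sN => /= /(_ I); rewrite ge0_fin_numE//.
have /choice[tau Htau] := right_sequence tD.
have tauD s n : range t (tau s n) by have [H _ _] := Htau s; exact: H.
have tau_gt s n : val s < val (tau s n) by have [_ H _] := Htau s; exact: H.
have tau_cvg (s : time T) (y : R) : val s < y -> \forall n \near \oo, val (tau s n) < y.
  by have [_ _ H] := Htau s; exact: H.
(* Off [good], an event of probability 0, the constant curve is taken, so that every path is cadlag
   of finite variation. *)
have /choice[G HG] : forall x, exists gx : time T -> X,
    [/\ cadlag (@emdist R X) gx, (curve_var (@emdist R X) gx setT < +oo)%E,
      (good x -> (forall s, mdist (h x (tau s n)) (gx s) @[n --> \oo] --> (0 : R)) /\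
        forall b, b <= T -> (curve_var (@emdist R X) gx [set s | (val s < b)%R] <=
         curve_var (@emdist R X) (h x) (range t `&` [set s | (val s < b)%R]))%E) &
      (~ good x -> gx = fun=> point)].
  move=> x; have [gx|ngx] := pselect (good x).
    have hv : (curve_var (@emdist R X) (h x) (range t) < +oo)%E.
      by move: gx; rewrite /good /f /= itv_ltT setIT.
    have [gx' [c1 c2 c3]] := regularize tD hv tauD tau_gt tau_cvg.
    exists gx'; split => //.
    have := c3 T (lexx _); rewrite itv_ltT setIT => /le_lt_trans; exact.
  exists (fun=> point); split => //.
    by have /asboolP := @cadlag_cst R X T.
  have -> : curve_var (@emdist R X) (fun _ : time T => point) setT = 0%E; last by [].
  apply/eqP; rewrite eq_le curve_var_ge0 andbT.
  apply: curve_var_le => l _ _; rewrite /vsum big1// => p _.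
  by rewrite /emdist mdistxx.
have mG s : measurable_fun setT ((fun x => G x s) : S -> borel X).
  apply: (@measurable_lim R X hX _ S (fun n x => if x \in good then h x (tau s n) else point)).
    by move=> n; apply: (measurable_if_set mgood) => //; exact: mh.
  move=> x; have [_ _ H1 H2] := HG x; case: (pselect (good x)) => [gx|ngx].
    rewrite (_ : (fun n => _) = (fun n => mdist (h x (tau s n)) (G x s))).
      by have [H _] := H1 gx; exact: H.
    by apply/funext => n; rewrite mem_set.
  rewrite (_ : (fun n => _) = cst 0); first exact: cvg_cst.
  by apply/funext => n; rewrite memNset// H2// mdistxx.
exists d, S, Q, G; split => //.
- by move=> x; have [] := HG x.
- by move=> x; have [] := HG x.
- move=> s; apply: (law_limit (u := fun n x => h x (tau s n)) _ (mG s) mgood good0) => //.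
  + by move=> x gx; have [_ _ /(_ gx)[H _] _] := HG x; exact: H.
  + move=> U r e oU r0 e0.
    (* Right continuity of [mu] is used at precision [e * r], since [W1_inner] divides the distance
       by [r]. *)
    have er0 : 0 < e * r by rewrite mulr_gt0.
    have [H _] := cm s; have := H _ er0.
    move=> /nbhs_ballP[eta /= eta0 Heta].
    have lt : val s < val s + eta by rewrite ltrDl.
    apply: filterS (tau_cvg s _ lt) => n sn.
    have Wlt : (W1 (mu (tau s n)) (mu s) < (e * r)%:E)%E.
      apply: (Heta (val (tau s n))) => //; last exact: tau_gt.
      by rewrite /ball/= distrC ger0_norm ?subr_ge0 ?(ltW (tau_gt s n))// ltrBlDl.
    have mI : measurable (inner U r : set (borel X)) by apply: measurable_open; exact: open_inner.
    rewrite lawh//; apply: le_trans (W1_inner hX oU r0 Wlt) _.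
    by rewrite -mulrA mulfV ?mulr1// gt_eqF.
move=> b bT; apply: le_trans (est b).
apply: ae_ge0_le_integral => //.
- by move=> x _; exact: curve_var_ge0.
- rewrite itv_lt; apply: measurable_curve_var_itv => // x.
  by apply: (cadlag_right_cont hE); have [] := HG x.
- by move=> x _; exact: curve_var_ge0.
- exact: (@measurable_curve_var_enum R X hX T d S t h (fun s => val s < b)).
exists (~` good); split; [exact: measurableC|exact: good0|].
move=> x /= H gx; apply: H => _; have [_ _ /(_ gx)[_ H] _] := HG x.
exact: H.
Qed.

End lift.

(** * Measurability on the space of cadlag curves *)

Section cadlag_measurability.
Context (R : realType) (X : completeMetricType R) (hX : separable_space X).
Context (T : R) (hT : 0 < T).

Lemma cadlag_spaceP (g : cadlag_space X T) : cadlag (@emdist R X) (val g).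
Proof. exact/asboolP/(valP g). Qed.

Lemma measurable_evaluation (s : time T) :
  measurable_fun [set: cadlag_space X T] ((fun g => val g s) : cadlag_space X T -> borel X).
Proof.
move=> _ B mB; rewrite setTI; apply: sub_gen_smallest.
by exists (s, B).
Qed.

Lemma measurable_to_cadlag d (S : measurableType d) (f : S -> cadlag_space X T) :
  (forall s, measurable_fun setT ((fun x => val (f x) s) : S -> borel X)) ->
  measurable_fun setT f.
Proof.
move=> mf; apply: (@measurability _ _ S (cadlag_space X T) setT f (@evaluation_cylinders R X T)) => //.
move=> _ [_ [[s B] /= mB <-] <-].
exact: (mf s measurableT B mB).
Qed.

Lemma measurable_curve_var_cadlag (a b : R) :
  measurable_fun [set: cadlag_space X T]
    (fun g : cadlag_space X T => curve_var (@emdist R X) (val g) [set s | (a < val s < b)%R]).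
Proof.
apply: (measurable_curve_var_itv hX hT) => [g|s]; last exact: measurable_evaluation.
exact: (cadlag_right_cont (ext_dist_emdist X) (cadlag_spaceP g)).
Qed.

Lemma bv_curve_cadlagE (g : cadlag_space X T) : bv_curve (@emdist R X) (val g) <->
  (curve_var (@emdist R X) (val g) [set s | (0 < val s < T)%R] < +oo)%E.
Proof.
rewrite itv0T bv_curveE; last exact: ext_dist_emdist.
by split => [[]//|H]; split => //; exact: cadlag_spaceP.
Qed.

Lemma measurable_bv : measurable [set g : cadlag_space X T | bv_curve (@emdist R X) (val g)].
Proof.
rewrite (_ : [set g | _] = [set g : cadlag_space X T |
    (curve_var (@emdist R X) (val g) [set s | (0 < val s < T)%R] < cst +oo g)%E]).
  rewrite -[X in measurable X]setTI; apply: measurable_lte => //.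
  exact: measurable_curve_var_cadlag.
by apply/seteqP; split => g /= /bv_curve_cadlagE.
Qed.

Lemma measurable_variation_measure_itv (b : R) : 0 < b -> b <= T ->
  measurable_fun [set: cadlag_space X T]
    (fun g : cadlag_space X T => variation_measure (@emdist R X) (val g) `]0, b[%classic).
Proof.
move=> b0 bT.
rewrite (_ : (fun g => _) = (fun g : cadlag_space X T =>
    if g \in [set g | bv_curve (@emdist R X) (val g)] then
      curve_var (@emdist R X) (val g) [set s | (0 < val s < b)%R] else 0%E)).
  apply: (measurable_if_set measurable_bv); first exact: measurable_curve_var_cadlag.
  exact: measurable_cst.
apply/funext => g; case: ifPn => [/set_mem bg|/negP nbg].
  exact: (variation_measure_itv (ext_dist_emdist X) bg).
rewrite (variation_measure0 hT (cadlag_spaceP g))//.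
by move=> /mem_set.
Qed.

End cadlag_measurability.

(** * From the intervals []0, b[] to all Borel sets *)

Section variation_lift.
Context (R : realType) (X : completeMetricType R) (hX : separable_space X).
Context (T : R) (hT : 0 < T) (mu : time T -> probability (borel X) R).
Context (pi : probability (cadlag_space X T) R).

Let M := variation_measure (@W1 R X) mu.
Let K (g : cadlag_space X T) := variation_measure (@emdist R X) (val g).

Hypothesis MK : forall b : R, 0 < b -> b <= T ->
  M `]0, b[%classic = (\int[pi]_g K g `]0%R, b[%classic)%E.

Let restrict_itv (m : {finite_measure set (measurableTypeR R) -> \bar R}) (B : set (measurableTypeR R)) :
  m (~` `]0, T[%classic) = 0%E -> measurable B -> m B = m (B `&` `]0, T[%classic).
Proof.
move=> m0 mB; have mI : measurable (`]0, T[%classic : set (measurableTypeR R)) by exact: measurable_itv.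
rewrite -[in LHS](setIT B) -(setUv `]0, T[%classic) setIUr measureU.
- rewrite [X in (_ + X)%E](_ : _ = 0%E) ?adde0//; apply/eqP; rewrite eq_le measure_ge0 andbT -m0.
  by apply: le_measure; rewrite ?inE//; [apply: measurableI => //; exact: measurableC|exact: measurableC].
- exact: measurableI.
- by apply: measurableI => //; exact: measurableC.
- by rewrite setIACA setICr setI0.
Qed.

(** The sets satisfying both claims form a Dynkin system. All the measures vanish off []0, T[], so
    on a ray []-oo, x[] they take their values on some []0, b[] or on the empty set, where [MK]
    applies; these rays are stable under intersection and generate the Borel sets. *)
Lemma variation_measure_lift (B : set (measurableTypeR R)) : measurable B ->
  measurable_fun [set: cadlag_space X T] (fun g => K g B) /\ M B = (\int[pi]_g K g B)%E.
Proof.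
pose P (A : set (measurableTypeR R)) :=
  measurable_fun [set: cadlag_space X T] (fun g => K g A) /\ M A = (\int[pi]_g K g A)%E.
have M0 : M (~` `]0, T[%classic) = 0%E by exact: variation_measureC.
have K0 g : K g (~` `]0, T[%classic) = 0%E by exact: variation_measureC.
have restr A : measurable A -> P (A `&` `]0, T[%classic) -> P A.
  move=> mA [P1 P2]; split.
    rewrite (_ : (fun g => _) = (fun g => K g (A `&` `]0, T[%classic)))//.
    by apply/funext => g; exact: restrict_itv.
  rewrite (restrict_itv M0 mA) P2; apply: eq_integral => g _.
  by rewrite [RHS](restrict_itv (K0 g) mA).
have Pb (b : R) : 0 < b -> b <= T -> P `]0, b[%classic.
  by move=> b0 bT; split; [exact: measurable_variation_measure_itv|exact: MK].
have P0 : P set0.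
  split; last by rewrite measure0; under eq_integral do rewrite measure0; rewrite integral0.
  rewrite (_ : (fun g => _) = cst 0%E); first exact: measurable_cst.
  by apply/funext => g; rewrite measure0.
have PT : P setT by apply: restr => //; rewrite setTI; exact: Pb.
have PG A : RGenInftyO.G A -> P A.
  move=> [x ->]; apply: restr; first exact: measurable_itv.
  have [x0|x0] := leP x 0.
    rewrite (_ : _ `&` _ = set0)//; apply/seteqP; split => // y [] /=.
    by rewrite !in_itv/= => yx /andP[y0 _]; have := lt_trans y0 yx; rewrite ltNge x0.
  have [xT|xT] := leP x T.
    rewrite (_ : _ `&` _ = `]0, x[%classic); first exact: Pb.
    apply/seteqP; split => y; rewrite /= !in_itv/=; first by move=> [-> /andP[->]].
    by move=> /andP[y0 yx]; rewrite yx y0 (lt_le_trans yx xT).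
  rewrite (_ : _ `&` _ = `]0, T[%classic); first exact: Pb.
  apply/seteqP; split => y; rewrite /= !in_itv/=; first by case.
  by move=> yT; split => //; case/andP: yT => _ /lt_trans; apply.
have compl (m : {finite_measure set (measurableTypeR R) -> \bar R}) A : measurable A ->
    m (~` A) = (m setT - m A)%E.
  move=> mA; rewrite -setTD measureD ?setTI//.
  by rewrite -ge0_fin_numE// fin_num_measure.
move=> mB; have := mB; rewrite RGenInftyO.measurableE; apply: (@dynkin_induction _ (measurableTypeR R) (@RGenInftyO.G R) P) => //.
- exact: RGenInftyO.measurableE.
- move=> _ _ [x ->] [y ->]; exists (Num.min x y).
  by apply/seteqP; split => z; rewrite /= !in_itv/= lt_min; [move=> [-> ->]|move=> /andP[-> ->]].
- move=> A mA [P1 P2].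
  have mKC : measurable_fun [set: cadlag_space X T] (fun g => K g (~` A)).
    rewrite (_ : (fun g => _) = (fun g => (K g setT - K g A)%E)).
      by apply: emeasurable_funB => //; exact: PT.1.
    by apply/funext => g; exact: compl.
  split => //.
  (* The integral over [A] equals [M A], which is finite, so it can be cancelled from the total
     mass. *)
  have : (M setT = \int[pi]_g K g A + \int[pi]_g K g (~` A))%E.
    rewrite PT.2 -ge0_integralD//; apply: eq_integral => g _.
    by rewrite compl// addeC subeK// fin_num_measure.
  rewrite -P2 compl// => ->.
  by rewrite addeC addeK// fin_num_measure.
move=> F mF tF PF; split.
  rewrite (_ : (fun g => _) = (fun g => \sum_(0 <= n <oo) K g (F n))%E).
    by apply: ge0_emeasurable_sum => // n _; exact: (PF n).1.
  by apply/funext => g; rewrite measure_semi_bigcup//; exact: bigcupT_measurable.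
rewrite measure_semi_bigcup//; last exact: bigcupT_measurable.
rewrite (eq_eseriesr (g := fun n => (\int[pi]_g K g (F n))%E)); last by move=> n _; exact: (PF n).2.
rewrite -integral_nneseries//; last by move=> n; exact: (PF n).1.
apply: eq_integral => g _; rewrite measure_semi_bigcup//.
exact: bigcupT_measurable.
Qed.

End variation_lift.

(* In the last item, the measurability of |Dg|(B) in g is what makes
   B |-> \int |Dg|(B) dpi(g) meaningful. *)
Theorem theorem4p3 (R : realType) (X : completeMetricType R)
    (hX : separable_space X) (T : R) (hT : 0 < T)
    (mu : time T -> probability (borel X) R)
    (hmu : bv_curve (@W1 R X) mu) :
  exists pi : probability (cadlag_space X T) R,
    [/\ {ae pi, forall g : cadlag_space X T, bv_curve (@emdist R X) (val g)},
        forall (t : time T) (B : set (borel X)), measurable B ->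
          pushforward pi (@evaluation R X T t) B = mu t B
      & forall B : set (measurableTypeR R), measurable B ->
          B `<=` `]0, T[%classic ->
          measurable_fun [set: cadlag_space X T]
            (fun g : cadlag_space X T =>
               variation_measure (@emdist R X) (val g) B) /\
          variation_measure (@W1 R X) mu B =
            (\int[pi]_g variation_measure (@emdist R X) (val g) B)%E].
Proof.
have hW := ext_dist_W1 hX; have hE := ext_dist_emdist X.
have [d [S [Q [g [cg fg mg gE gI]]]]] := lift_exists hX hT hmu.
pose G x : cadlag_space X T :=
  exist (fun g : time T -> X => `[< cadlag (@emdist R X) g >]) (g x) (asboolT (cg x)).
have mG : measurable_fun setT G by apply: measurable_to_cadlag => s; exact: mg.
have [pi [piE piI]] := law_exists Q mG.
have bvG x : bv_curve (@emdist R X) (val (G x)).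
  by apply: (bv_curveE hE _).2; split; [exact: cg|exact: fg].
have muE s (B : set (borel X)) : measurable B -> pi ((fun g => val g s) @^-1` B) = mu s B.
  by move=> mB; rewrite piE -gE.
have MK (b : R) : 0 < b -> b <= T ->
    variation_measure (@W1 R X) mu `]0, b[%classic =
    (\int[pi]_g variation_measure (@emdist R X) (val g) `]0%R, b[%classic)%E.
  move=> b0 bT; rewrite (variation_measure_itv hW hmu)//.
  rewrite piI//; last exact: measurable_variation_measure_itv.
  rewrite (eq_integral (fun x => curve_var (@emdist R X) (g x) [set s | (0 < val s < b)%R])); last first.
    by move=> x _; rewrite (variation_measure_itv hE (bvG x)).
  apply/eqP; rewrite eq_le; apply/andP; split; last by rewrite -itv_lt; exact: gI.
  apply: (W1_var_le hX mg gE); apply: (measurable_curve_var_itv hX hT) => // x.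
  exact: (cadlag_right_cont hE (cg x)).
exists pi; split.
(* Every path of the lift is in BV, so the preimage under [G] of the exceptional set is empty. *)
- exists (~` [set g : cadlag_space X T | bv_curve (@emdist R X) (val g)]); split => //.
    by apply: measurableC; exact: measurable_bv.
  rewrite piE (_ : _ @^-1` _ = set0) ?measure0//.
  by apply/seteqP; split => // x /(_ (bvG x)).
- by move=> s B mB; exact: muE.
by move=> B mB _; exact: (variation_measure_lift hX hT MK mB).
Qed.
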